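(* Let $0<q<1$ and $N\in\mathbb Z$. The $\bar\partial$-connection $\nabla_N^{\bar\partial}$ on the canonical quantum line bundle $\mathcal L_N$ over $\mathbb CP^2_q$ is flat, i.e. $(\nabla_N^{\bar\partial})^2=0$ as a map $\mathcal L_N\to\Omega^{(0,2)}\otimes_{\mathcal A(\mathbb CP^2_q)}\mathcal L_N$.
   Context: Fix $0<q<1$; $[z]=\frac{q^z-q^{-z}}{q-q^{-1}}$, $[n]!=[1][2]\cdots[n]$, $[j,k,l]!=q^{-(jk+kl+lj)}\frac{[j+k+l]!}{[j]!\,[k]!\,[l]!}$. $U_q(\mathfrak{su}(3))$ is the Hopf $*$-algebra generated by $K_i^{\pm1},E_i,F_i$ ($i=1,2$), $K_i^*=K_i$, $E_i^*=F_i$, with $[K_1,K_2]=0$, $K_iE_i=qE_iK_i$, $[E_i,F_i]=\frac{K_i^2-K_i^{-2}}{q-q^{-1}}$, and for $i\ne j$: $K_iE_j=q^{-1/2}E_jK_i$, $[E_i,F_j]=0$, $E_i^2E_j+E_jE_i^2=(q+q^{-1})E_iE_jE_i$; $\Delta(K_i)=K_i\otimes K_i$, $\Delta(E_i)=E_i\otimes K_i+K_i^{-1}\otimes E_i$, $\Delta(F_i)=F_i\otimes K_i+K_i^{-1}\otimes F_i$; $\epsilon(K_i)=1$, $\epsilon(E_i)=\epsilon(F_i)=0$; $S(K_i)=K_i^{-1}$, $S(E_i)=-qE_i$, $S(F_i)=-q^{-1}F_i$. $\mathcal A(SU_q(3))$ is the $*$-algebra generated by $u^i_j$ ($i,j=1,2,3$)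 with $u^i_ku^j_k=qu^j_ku^i_k$ and $u^k_iu^k_j=qu^k_ju^k_i$ for $i<j$; $[u^i_l,u^j_k]=0$ and $[u^i_k,u^j_l]=(q-q^{-1})u^i_lu^j_k$ for $i<j$, $k<l$; $\sum_{\pi\in S_3}(-q)^{\ell(\pi)}u^1_{\pi(1)}u^2_{\pi(2)}u^3_{\pi(3)}=1$; and $(u^i_j)^*=(-q)^{j-i}(u^{k_1}_{l_1}u^{k_2}_{l_2}-qu^{k_1}_{l_2}u^{k_2}_{l_1})$, where $\{k_1<k_2\}=\{1,2,3\}\setminus\{i\}$, $\{l_1<l_2\}=\{1,2,3\}\setminus\{j\}$. It carries a right action of $U_q(\mathfrak{su}(3))$ with $(ab)\triangleleft h=(a\triangleleft h_{(1)})(b\triangleleft h_{(2)})$, $1\triangleleft h=\epsilon(h)1$, $(a\triangleleft h)^*=a^*\triangleleft S(h)^*$, and $u^j_k\triangleleft K_i=q^{\frac12(\delta_{i+1,j}-\delta_{i,j})}u^j_k$, $u^j_k\triangleleft E_i=\delta_{i+1,j}u^i_k$, $u^j_k\triangleleft F_i=\delta_{i,j}u^{i+1}_k$. Let $U_q(\mathfrak{su}(2))$ be the subalgebra generated by $K_1^{\pm1},E_1,F_1$. Put $\mathcal A(S^5_q)=\{a\in\mathcal A(SU_q(3)): a\triangleleft h=\epsilon(h)a\ \forall h\in U_q(\mathfrak{su}(2))\}$, generated as a $*$-algebra by $z_j=u^3_j$; for $N\in\mathbb Z$, $\mathcal L_N=\{a\in\mathcal A(S^5_q): a\triangleleft K_1K_2^2=q^Na\}$;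 and $\mathcal A(\mathbb CP^2_q)=\mathcal L_0$. Each $\mathcal L_N$ is an $\mathcal A(\mathbb CP^2_q)$-bimodule by multiplication. Antiholomorphic calculus: $\Omega^{(0,0)}=\mathcal A(\mathbb CP^2_q)$; $\Omega^{(0,1)}$ is the set of pairs $v=(v_+,v_-)^t\in\mathcal A(SU_q(3))^2$ such that (componentwise action) $(v_+,v_-)\triangleleft K_1K_2^2=q^{3/2}(v_+,v_-)$, $(v_+,v_-)\triangleleft K_1=(q^{1/2}v_+,q^{-1/2}v_-)$, $(v_+,v_-)\triangleleft F_1=(0,v_+)$, $(v_+,v_-)\triangleleft E_1=(v_-,0)$, an $\mathcal A(\mathbb CP^2_q)$-bimodule by componentwise multiplication; $\Omega^{(0,2)}=\mathcal L_3$. On functions $\bar\partial a=(a\triangleleft F_2F_1,\ a\triangleleft F_2)^t$. Up to overall nonzero normalization, the product $\Omega^{(0,1)}\times\Omega^{(0,1)}\to\Omega^{(0,2)}$ is $v\cdot w=q^{1/2}v_+w_--q^{-1/2}v_-w_+$ and $\bar\partial:\Omega^{(0,1)}\to\Omega^{(0,2)}$ is $\bar\partial v=v_-\triangleleft F_2F_1-[2]\,v_+\triangleleft F_2$; thus $\bar\partial^2=0$ and $\bar\partial$ satisfies the graded Leibniz rule. $\Psi_N$ is the column vector with components $\psi^N_{j,k,l}$ ($j,k,l\ge0$, $j+k+l=|N|$), where $(\psi^N_{j,k,l})^*=\sqrt{[j,k,l]!}\,z_1^jz_2^kz_3^l$ if $N\ge0$ and $(\psi^N_{j,k,l})^*=q^{-N+j-l}\sqrt{[j,k,l]!}\,(z_1^jz_2^kz_3^l)^*$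 if $N\le 0$; then $\Psi_N^\dagger\Psi_N=1$. For $\xi\in\mathcal L_N$ the entries of $\Psi_N\xi$ are in $\mathcal A(\mathbb CP^2_q)$. The multiplication maps $\Omega^{(0,p)}\otimes_{\mathcal A(\mathbb CP^2_q)}\mathcal L_N\to\mathcal A(SU_q(3))^2$ ($p=1$), $\to\mathcal A(SU_q(3))$ ($p=2$), are injective and identify the tensor products with their images. The $\bar\partial$-connection is $\nabla_N^{\bar\partial}:\mathcal L_N\to\Omega^{(0,1)}\otimes_{\mathcal A(\mathbb CP^2_q)}\mathcal L_N$, $\nabla_N^{\bar\partial}\xi=q^{-N}\Psi_N^\dagger\,\bar\partial(\Psi_N\xi)=q^{-N}\Psi_N^\dagger\big((\Psi_N\xi)\triangleleft F_2F_1,\ (\Psi_N\xi)\triangleleft F_2\big)^t$. It is extended to $\Omega^{(0,1)}\otimes_{\mathcal A(\mathbb CP^2_q)}\mathcal L_N\to\Omega^{(0,2)}\otimes_{\mathcal A(\mathbb CP^2_q)}\mathcal L_N$ by the graded Leibniz rule $\nabla_N^{\bar\partial}(\omega\otimes\xi)=\bar\partial\omega\otimes\xi-\omega\,\nabla_N^{\bar\partial}\xi$. *)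

(* Defs.v *)
From HB Require Import structures.
From mathcomp Require Import all_boot all_order all_algebra.
From mathcomp Require Import perm boolp reals complex.
Set Implicit Arguments.
Unset Strict Implicit.
Unset Printing Implicit Defensive.
Import Order.TTheory GRing.Theory Num.Theory.
Local Open Scope ring_scope.
Local Open Scope quotient_scope.

(* -------------------------------------------------------------------------- *)
(* Unital complex *-algebras given by generators and relations.               *)
(* The set X of generators is closed under an involution x |-> x^*, and the   *)
(* algebra is the quotient of the free algebra on X (presented by expressions *)
(* [aexpr]) by the two-sided ideal spanned by the relations and their adjoints.*)
(* -------------------------------------------------------------------------- *)

Inductive aexpr (C X : Type) : Type :=
| Gen of X
| Scal of C
| Add of aexpr C X & aexpr C X
| Mul of aexpr C X & aexpr C X.
Arguments Gen {C X}.
Arguments Scal {C X}.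
Arguments Add {C X}.
Arguments Mul {C X}.

Declare Scope aexpr_scope.
Delimit Scope aexpr_scope with X.
Bind Scope aexpr_scope with aexpr.
Notation "s + t" := (Add s t) : aexpr_scope.
Notation "s * t" := (Mul s t) : aexpr_scope.
Notation "c *: t" := (Mul (Scal c%R) t) : aexpr_scope.
Notation "s - t" := (Add s (Mul (Scal (-1)%R) t)) : aexpr_scope.
Notation "0" := (Scal 0%R) : aexpr_scope.
Notation "1" := (Scal 1%R) : aexpr_scope.

HB.instance Definition _ (C X : Type) := gen_eqMixin (aexpr C X).
HB.instance Definition _ (C X : Type) := gen_choiceMixin (aexpr C X).

Fixpoint aexpr_eval (C : pzSemiRingType) (X : Type) (f : X -> C) (t : aexpr C X) : C :=
  match t with
  | Gen x => f x
  | Scal c => c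
  | Add s t => aexpr_eval f s + aexpr_eval f t
  | Mul s t => aexpr_eval f s * aexpr_eval f t
  end.

(* The adjoint: antimultiplicative and antilinear. *)
Fixpoint aexpr_star (C : numClosedFieldType) (X : Type) (st : X -> X)
    (t : aexpr C X) : aexpr C X :=
  match t with
  | Gen x => Gen (st x)
  | Scal c => Scal c^*
  | Add s t => Add (aexpr_star st s) (aexpr_star st t)
  | Mul s t => Mul (aexpr_star st t) (aexpr_star st s)
  end.

(* [paug] is a *-character of the presented algebra.  It ensures 1 != 0; for  *)
(* a Hopf algebra it is the counit.                                           *)
Record presentation (C : numClosedFieldType) : Type := Presentation {
  pgen : Type;
  pstar : pgen -> pgen;
  pstarK : involutive pstar;
  prel : aexpr C pgen -> aexpr C pgen -> Prop;
  paug : pgen -> C;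
  paug_star : forall x, paug (pstar x) = (paug x)^*;
  paug_rel : forall s t, prel s t -> aexpr_eval paug s = aexpr_eval paug t
}.

Section PresentedAlgebra.
Variables (C : numClosedFieldType) (P : presentation C).
Local Notation tm := (aexpr C (pgen P)).
Local Notation star := (aexpr_star (@pstar C P)).
Local Open Scope aexpr_scope.

Inductive peqv : tm -> tm -> Prop :=
| peqv_refl s : peqv s s
| peqv_sym s t : peqv s t -> peqv t s
| peqv_trans s t r : peqv s t -> peqv t r -> peqv s r
| peqv_add s s' t t' : peqv s s' -> peqv t t' -> peqv (s + t) (s' + t')
| peqv_mul s s' t t' : peqv s s' -> peqv t t' -> peqv (s * t) (s' * t')
| peqv_addA s t r : peqv (s + (t + r)) ((s + t) + r)
| peqv_addC s t : peqv (s + t) (t + s)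
| peqv_add0 s : peqv (0 + s) s
| peqv_mulA s t r : peqv (s * (t * r)) ((s * t) * r)
| peqv_mul1 s : peqv (1 * s) s
| peqv_mul0 s : peqv (0 * s) 0
| peqv_mulDl s t r : peqv ((s + t) * r) (s * r + t * r)
| peqv_mulDr s t r : peqv (s * (t + r)) (s * t + s * r)
| peqv_scalD a b : peqv (Scal (a + b)%R) (Scal a + Scal b)
| peqv_scalM a b : peqv (Scal (a * b)%R) (Scal a * Scal b)
| peqv_scalC a s : peqv (Scal a * s) (s * Scal a)
| peqv_rel s t : prel s t -> peqv s t
| peqv_rel_star s t : prel s t -> peqv (star s) (star t).

Definition peqvb (s t : tm) : bool := `[< peqv s t >].

Lemma peqvb_refl : reflexive peqvb.
Proof. by move=> s; apply/asboolP; apply: peqv_refl. Qed.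

Lemma peqvb_sym : symmetric peqvb.
Proof. by move=> s t; apply/asboolP/asboolP; apply: peqv_sym. Qed.

Lemma peqvb_trans : transitive peqvb.
Proof.
move=> s t r /asboolP h1 /asboolP h2; apply/asboolP.
exact: peqv_trans h1 h2.
Qed.

Canonical peqv_equiv := EquivRel peqvb peqvb_refl peqvb_sym peqvb_trans.

Definition palg : Type := {eq_quot peqv_equiv}.
HB.instance Definition _ := Choice.on palg.

Definition pcls (t : tm) : palg := \pi_{eq_quot peqv_equiv} t.
Definition prepr (x : palg) : tm := repr (x : {eq_quot peqv_equiv}).

Lemma pclsP s t : pcls s = pcls t <-> peqv s t.
Proof.
split=> [|h]; first by move=> h; apply/asboolP; exact/(@eqmodP _ peqv_equiv).
by apply/(@eqmodP _ peqv_equiv)/asboolP.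
Qed.

Lemma pclsK x : pcls (prepr x) = x.
Proof. exact: reprK. Qed.

Lemma pcls_ind (Q : palg -> Prop) : (forall t, Q (pcls t)) -> forall x, Q x.
Proof. by move=> h x; rewrite -[x]pclsK; apply: h. Qed.

Lemma prepr_pcls t : peqv (prepr (pcls t)) t.
Proof. by apply/pclsP; rewrite pclsK. Qed.

Definition palg_add (x y : palg) := pcls (prepr x + prepr y).
Definition palg_mul (x y : palg) := pcls (prepr x * prepr y).
Definition palg_scal (c : C) (x : palg) := pcls (c *: prepr x).
Definition palg_opp (x : palg) := palg_scal (-1)%R x.
Definition palg_star (x : palg) := pcls (star (prepr x)).
Definition palg_aug (x : palg) : C := aexpr_eval (@paug C P) (prepr x).

Lemma pclsD s t : pcls (s + t) = palg_add (pcls s) (pcls t).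
Proof. by apply/pclsP/peqv_sym/peqv_add; apply: prepr_pcls. Qed.

Lemma pclsM s t : pcls (s * t) = palg_mul (pcls s) (pcls t).
Proof. by apply/pclsP/peqv_sym/peqv_mul; apply: prepr_pcls. Qed.

Lemma pclsZ c t : pcls (c *: t) = palg_scal c (pcls t).
Proof.
apply/pclsP/peqv_sym/peqv_mul; first exact: peqv_refl.
exact: prepr_pcls.
Qed.

Fact palg_addA : associative palg_add.
Proof.
elim/pcls_ind=> s; elim/pcls_ind=> t; elim/pcls_ind=> r.
by rewrite -!pclsD; apply/pclsP/peqv_addA.
Qed.

Fact palg_addC : commutative palg_add.
Proof.
elim/pcls_ind=> s; elim/pcls_ind=> t.
by rewrite -!pclsD; apply/pclsP/peqv_addC.
Qed.

Fact palg_add0 : left_id (pcls 0) palg_add.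
Proof. by elim/pcls_ind=> s; rewrite -pclsD; apply/pclsP/peqv_add0. Qed.

Fact palg_mul1 : left_id (pcls 1) palg_mul.
Proof. by elim/pcls_ind=> s; rewrite -pclsM; apply/pclsP/peqv_mul1. Qed.

Fact palg_mulr1 : right_id (pcls 1) palg_mul.
Proof.
elim/pcls_ind=> s; rewrite -pclsM; apply/pclsP.
apply: peqv_trans (peqv_sym (peqv_scalC _ _)) _; exact: peqv_mul1.
Qed.

Fact palg_mulA : associative palg_mul.
Proof.
elim/pcls_ind=> s; elim/pcls_ind=> t; elim/pcls_ind=> r.
by rewrite -!pclsM; apply/pclsP/peqv_mulA.
Qed.

Fact palg_mulDl : left_distributive palg_mul palg_add.
Proof.
elim/pcls_ind=> s; elim/pcls_ind=> t; elim/pcls_ind=> r.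
by rewrite -!(pclsM, pclsD); apply/pclsP/peqv_mulDl.
Qed.

Fact palg_mulDr : right_distributive palg_mul palg_add.
Proof.
elim/pcls_ind=> s; elim/pcls_ind=> t; elim/pcls_ind=> r.
by rewrite -!(pclsM, pclsD); apply/pclsP/peqv_mulDr.
Qed.

Fact palg_scal1 : left_id (GRing.one C) palg_scal.
Proof. by elim/pcls_ind=> s; rewrite -pclsZ; apply/pclsP/peqv_mul1. Qed.

Fact palg_scalDl x : {morph palg_scal^~ x : a b / (a + b)%R >-> palg_add a b}.
Proof.
elim/pcls_ind: x => s a b; rewrite -!pclsZ -pclsD; apply/pclsP.
apply: peqv_trans (peqv_mulDl _ _ _); apply: peqv_mul (peqv_refl _).
exact: peqv_scalD.
Qed.

Fact palg_scalDr : right_distributive palg_scal palg_add.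
Proof.
move=> a; elim/pcls_ind=> s; elim/pcls_ind=> t.
by rewrite -!(pclsZ, pclsD); apply/pclsP/peqv_mulDr.
Qed.

Fact palg_scalA a b x : palg_scal a (palg_scal b x) = palg_scal (a * b)%R x.
Proof.
elim/pcls_ind: x => s; rewrite -!pclsZ; apply/pclsP.
apply: peqv_trans (peqv_mulA _ _ _) _; apply: peqv_mul (peqv_refl _).
exact/peqv_sym/peqv_scalM.
Qed.

Fact palg_scalAl a x y : palg_scal a (palg_mul x y) = palg_mul (palg_scal a x) y.
Proof.
elim/pcls_ind: x => s; elim/pcls_ind: y => t.
by rewrite -!(pclsM, pclsZ); apply/pclsP/peqv_mulA.
Qed.

Fact palg_scalAr a x y : palg_scal a (palg_mul x y) = palg_mul x (palg_scal a y).
Proof.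
elim/pcls_ind: x => s; elim/pcls_ind: y => t.
rewrite -!(pclsM, pclsZ); apply/pclsP.
apply: peqv_trans (peqv_mulA _ _ _) _; apply: peqv_trans (peqv_sym (peqv_mulA _ _ _)).
by apply: peqv_mul (peqv_refl _); apply: peqv_scalC.
Qed.

Fact palg_addN : left_inverse (pcls 0) palg_opp palg_add.
Proof.
move=> x; rewrite -{2}[x]palg_scal1 -palg_scalDl addNr.
by elim/pcls_ind: x => s; rewrite -pclsZ; apply/pclsP/peqv_mul0.
Qed.

Lemma aexpr_eval_star (t : tm) :
  aexpr_eval (@paug C P) (star t) = (aexpr_eval (@paug C P) t)^*.
Proof.
elim: t => [x|c|s IHs t IHt|s IHs t IHt] //=; first exact: paug_star.
  by rewrite IHs IHt rmorphD.
by rewrite IHs IHt rmorphM mulrC.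
Qed.

Lemma peqv_aug s t :
  peqv s t -> aexpr_eval (@paug C P) s = aexpr_eval (@paug C P) t.
Proof.
elim=> //= {s t}; do ?by move=> *; congruence.
- by move=> *; rewrite addrA.
- by move=> *; rewrite addrC.
- by move=> *; rewrite add0r.
- by move=> *; rewrite mulrA.
- by move=> *; rewrite mul1r.
- by move=> *; rewrite mul0r.
- by move=> *; rewrite mulrDl.
- by move=> *; rewrite mulrDr.
- by move=> *; rewrite mulrC.
- exact: paug_rel.
- by move=> s t h; rewrite !aexpr_eval_star (paug_rel h).
Qed.

Fact palg_one_neq0 : pcls 1 != pcls 0.
Proof. by apply/eqP => /pclsP/peqv_aug/= /eqP; rewrite oner_eq0. Qed.

HB.instance Definition _ := @GRing.isZmodule.Build palg
  (pcls 0) palg_opp palg_add palg_addA palg_addC palg_add0 palg_addN.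
HB.instance Definition _ := @GRing.Zmodule_isNzRing.Build palg
  (pcls 1) palg_mul palg_mulA palg_mul1 palg_mulr1 palg_mulDl palg_mulDr
  palg_one_neq0.
HB.instance Definition _ := @GRing.Zmodule_isLmodule.Build C palg
  palg_scal palg_scalA palg_scal1 palg_scalDr palg_scalDl.
HB.instance Definition _ :=
  @GRing.Lmodule_isLalgebra.Build C palg palg_scalAl.
HB.instance Definition _ :=
  @GRing.Lalgebra_isAlgebra.Build C palg palg_scalAr.

Lemma aexpr_starK (t : tm) : star (star t) = t.
Proof.
by elim: t => [x|c|s IHs t IHt|s IHs t IHt] /=;
  rewrite ?pstarK ?conjCK ?IHs ?IHt.
Qed.

Lemma peqv_star s t : peqv s t -> peqv (star s) (star t).
Proof.
elim=> {s t} /=; rewrite ?rmorph0 ?rmorph1.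
- by move=> s; apply: peqv_refl.
- by move=> s t _; apply: peqv_sym.
- by move=> s t r _ h1 _; apply: peqv_trans.
- by move=> *; apply: peqv_add.
- by move=> *; apply: peqv_mul.
- by move=> *; apply: peqv_addA.
- by move=> *; apply: peqv_addC.
- by move=> *; apply: peqv_add0.
- by move=> *; apply/peqv_sym/peqv_mulA.
- by move=> s; apply: peqv_trans (peqv_sym (peqv_scalC _ _)) (peqv_mul1 _).
- by move=> s; apply: peqv_trans (peqv_sym (peqv_scalC _ _)) (peqv_mul0 _).
- by move=> *; apply: peqv_mulDr.
- by move=> *; apply: peqv_mulDl.
- by move=> a b; rewrite rmorphD; apply: peqv_scalD.
- by move=> a b; rewrite rmorphM mulrC; apply: peqv_scalM.
- by move=> *; apply/peqv_sym/peqv_scalC.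
- by move=> s t; apply: peqv_rel_star.
- by move=> s t h; rewrite !aexpr_starK; apply: peqv_rel.
Qed.

Lemma palg_star_cls t : palg_star (pcls t) = pcls (star t).
Proof. by apply/pclsP/peqv_star/prepr_pcls. Qed.

Lemma palg_aug_cls t : palg_aug (pcls t) = aexpr_eval (@paug C P) t.
Proof. exact/peqv_aug/prepr_pcls. Qed.

End PresentedAlgebra.
Arguments pcls {C P} t%_X.

(* -------------------------------------------------------------------------- *)
(* q-numbers                                                                  *)
(* -------------------------------------------------------------------------- *)

Section QNumbers.
Variables (R : realType) (q : R).

(* q^n and q^(n/2), as complex numbers *)
Definition qpow (n : int) : R[i] := (q ^ n)%:C%C.
Definition qhalf (n : int) : R[i] := (Num.sqrt q ^ n)%:C%C.

Definition qnum (n : int) : R := (q ^ n - q ^ (- n)) / (q - q^-1).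
Definition qfact (n : nat) : R := \prod_(1 <= m < n.+1) qnum m%:Z.
Definition qmultinom (j k l : nat) : R :=
  q ^- (j * k + k * l + l * j)%N *
  (qfact (j + k + l)%N / (qfact j * qfact k * qfact l)).

End QNumbers.

(* -------------------------------------------------------------------------- *)
(* U_q(su(3)); the generators i = 1, 2 are indexed by 'I_2 = {0, 1}.          *)
(* The relations for the F_i are the adjoints of those for the E_i.           *)
(* -------------------------------------------------------------------------- *)

Inductive Ugen : Type :=
| GK of 'I_2 | GKi of 'I_2 | GE of 'I_2 | GF of 'I_2.

Definition Ugen_star (x : Ugen) : Ugen :=
  match x with GK i => GK i | GKi i => GKi i | GE i => GF i | GF i => GE i end.

Lemma Ugen_starK : involutive Ugen_star. Proof. by case. Qed.

Section Uqsu3.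
Variables (R : realType) (q : R).
Local Notation K i := (Gen (GK i)).
Local Notation Ki i := (Gen (GKi i)).
Local Notation E i := (Gen (GE i)).
Local Notation F i := (Gen (GF i)).

Inductive U_rel : aexpr R[i] Ugen -> aexpr R[i] Ugen -> Prop :=
| U_rel_KKi i : U_rel (K i * Ki i)%X 1%X
| U_rel_KiK i : U_rel (Ki i * K i)%X 1%X
| U_rel_KK i j : U_rel (K i * K j)%X (K j * K i)%X
| U_rel_KE i : U_rel (K i * E i)%X (qpow q 1 *: (E i * K i))%X
| U_rel_EF i :
    U_rel (E i * F i - F i * E i)%X
          ((qpow q 1 - qpow q (-1))^-1 *: (K i * K i - Ki i * Ki i))%X
| U_rel_KE' i j : i != j -> U_rel (K i * E j)%X (qhalf q (-1) *: (E j * K i))%X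
| U_rel_EF' i j : i != j -> U_rel (E i * F j - F j * E i)%X 0%X
| U_rel_Serre i j : i != j ->
    U_rel (E i * E i * E j + E j * E i * E i)%X
          ((qpow q 1 + qpow q (-1)) *: (E i * E j * E i))%X.

Definition Ugen_counit (x : Ugen) : R[i] :=
  match x with GK _ | GKi _ => 1 | GE _ | GF _ => 0 end.

Fact Ugen_counit_star x : Ugen_counit (Ugen_star x) = (Ugen_counit x)^*.
Proof. by case: x => i /=; rewrite ?rmorph0 ?rmorph1. Qed.

Fact Ugen_counit_rel s t :
  U_rel s t -> aexpr_eval Ugen_counit s = aexpr_eval Ugen_counit t.
Proof. by case=> * /=; rewrite !(mulr0, mul0r, addr0, mulr1, mulN1r, subrr). Qed.

Definition Uqsu3_pres : presentation R[i] :=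
  Presentation Ugen_starK Ugen_counit_star Ugen_counit_rel.
Definition Uqsu3 : Type := palg Uqsu3_pres.
HB.instance Definition _ := GRing.Algebra.on Uqsu3.

Definition uclass (h : aexpr R[i] Ugen) : Uqsu3 := pcls (P := Uqsu3_pres) h.
Definition ustar (h : Uqsu3) : Uqsu3 := palg_star h.
Definition counit (h : Uqsu3) : R[i] := palg_aug h.

Definition uK (i : 'I_2) : Uqsu3 := uclass (K i).
Definition uKi (i : 'I_2) : Uqsu3 := uclass (Ki i).
Definition uE (i : 'I_2) : Uqsu3 := uclass (E i).
Definition uF (i : 'I_2) : Uqsu3 := uclass (F i).

(* The coproduct and the antipode, on representatives; a tensor               *)
(* h_1 (x) k_1 + ... + h_n (x) k_n is the list [:: (h_1, k_1); ...; (h_n, k_n)].*)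
Definition Ugen_coproduct (x : Ugen) :
    seq (aexpr R[i] Ugen * aexpr R[i] Ugen) :=
  match x with
  | GK i => [:: (K i, K i)]
  | GKi i => [:: (Ki i, Ki i)]
  | GE i => [:: (E i, K i); (Ki i, E i)]
  | GF i => [:: (F i, K i); (Ki i, F i)]
  end.

Fixpoint coproduct (h : aexpr R[i] Ugen) :
    seq (aexpr R[i] Ugen * aexpr R[i] Ugen) :=
  match h with
  | Gen x => Ugen_coproduct x
  | Scal c => [:: (Scal c, 1%X)]
  | Add h k => coproduct h ++ coproduct k
  | Mul h k => [seq ((x.1 * y.1)%X, (x.2 * y.2)%X) |
                 x <- coproduct h, y <- coproduct k]
  end.

Fixpoint antipode (h : aexpr R[i] Ugen) : aexpr R[i] Ugen :=
  match h with
  | Gen (GK i) => Ki i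
  | Gen (GKi i) => K i
  | Gen (GE i) => (- qpow q 1 *: E i)%X
  | Gen (GF i) => (- qpow q (-1) *: F i)%X
  | Scal c => Scal c
  | Add h k => (antipode h + antipode k)%X
  | Mul h k => (antipode k * antipode h)%X
  end.

(* The unital subalgebra U_q(su(2)) generated by K_1, K_1^-1, E_1, F_1. *)
Inductive in_Uqsu2 : Uqsu3 -> Prop :=
| in_Uqsu2_K : in_Uqsu2 (uK ord0)
| in_Uqsu2_Ki : in_Uqsu2 (uKi ord0)
| in_Uqsu2_E : in_Uqsu2 (uE ord0)
| in_Uqsu2_F : in_Uqsu2 (uF ord0)
| in_Uqsu2_1 : in_Uqsu2 1
| in_Uqsu2_Z c h : in_Uqsu2 h -> in_Uqsu2 (c *: h)
| in_Uqsu2_D h k : in_Uqsu2 h -> in_Uqsu2 k -> in_Uqsu2 (h + k)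
| in_Uqsu2_M h k : in_Uqsu2 h -> in_Uqsu2 k -> in_Uqsu2 (h * k).

End Uqsu3.

(* -------------------------------------------------------------------------- *)
(* A(SU_q(3)); the indices 1, 2, 3 are represented by 'I_3 = {0, 1, 2}.       *)
(* [Gu i j] stands for u^i_j and [Gus i j] for its adjoint.                   *)
(* -------------------------------------------------------------------------- *)

Inductive SUgen : Type := Gu of 'I_3 & 'I_3 | Gus of 'I_3 & 'I_3.

Definition SUgen_star (x : SUgen) : SUgen :=
  match x with Gu i j => Gus i j | Gus i j => Gu i j end.

Lemma SUgen_starK : involutive SUgen_star. Proof. by case. Qed.

Definition row1 : 'I_3 := @Ordinal 3 0 isT.
Definition row2 : 'I_3 := @Ordinal 3 1 isT.
Definition row3 : 'I_3 := @Ordinal 3 2 isT.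

Definition perm_length (s : 'S_3) : nat :=
  #|[set p : 'I_3 * 'I_3 | (p.1 < p.2)%N && (s p.2 < s p.1)%N]|.

Section SUq3.
Variables (R : realType) (q : R).
Local Notation u i j := (Gen (Gu i j)).
Local Notation us i j := (Gen (Gus i j)).

Inductive SU_rel : aexpr R[i] SUgen -> aexpr R[i] SUgen -> Prop :=
| SU_rel_col (i j k : 'I_3) : (i < j)%N ->
    SU_rel (u i k * u j k)%X (qpow q 1 *: (u j k * u i k))%X
| SU_rel_row (i j k : 'I_3) : (i < j)%N ->
    SU_rel (u k i * u k j)%X (qpow q 1 *: (u k j * u k i))%X
| SU_rel_comm (i j k l : 'I_3) : (i < j)%N -> (k < l)%N ->
    SU_rel (u i l * u j k - u j k * u i l)%X 0%X
| SU_rel_cross (i j k l : 'I_3) : (i < j)%N -> (k < l)%N ->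
    SU_rel (u i k * u j l - u j l * u i k)%X
           ((qpow q 1 - qpow q (-1)) *: (u i l * u j k))%X
| SU_rel_det :
    SU_rel (\big[Add/0%X]_(s : 'S_3)
              ((- qpow q 1) ^+ perm_length s *:
                 (u row1 (s row1) * u row2 (s row2) * u row3 (s row3)))%X) 1%X
| SU_rel_star (i j k1 k2 l1 l2 : 'I_3) : (k1 < k2)%N -> (l1 < l2)%N ->
    [set k1; k2] = [set~ i] -> [set l1; l2] = [set~ j] ->
    SU_rel (us i j)
           ((- qpow q 1) ^ (j%:Z - i%:Z) *:
              (u k1 l1 * u k2 l2 - qpow q 1 *: (u k1 l2 * u k2 l1)))%X.

(* the counit of A(SU_q(3)) *)
Definition SUgen_counit (x : SUgen) : R[i] :=
  match x with Gu i j | Gus i j => (i == j)%:R end.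

Fact SUgen_counit_star x : SUgen_counit (SUgen_star x) = (SUgen_counit x)^*.
Proof. by case: x => i j /=; rewrite conjC_nat. Qed.

Lemma aexpr_eval_sum (f : SUgen -> R[i]) (I : Type) (r : seq I) (P : pred I)
    (G : I -> aexpr R[i] SUgen) :
  aexpr_eval f (\big[Add/0%X]_(i <- r | P i) G i) =
  \sum_(i <- r | P i) aexpr_eval f (G i).
Proof. exact: (big_morph (aexpr_eval f)). Qed.

Lemma ltn_ord_eqF n (i j : 'I_n) : (i < j)%N -> (i == j) = false.
Proof. by move=> lt_ij; apply/negbTE; rewrite neq_ltn lt_ij. Qed.

Fact SUgen_counit_rel s t :
  SU_rel s t -> aexpr_eval SUgen_counit s = aexpr_eval SUgen_counit t.
Proof.
case=> {s t} /=.
- move=> i j k /ltn_ord_eqF; case: (i =P k) => [->|]; last by rewrite mul0r !mulr0.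
  by rewrite eq_sym => ->; rewrite !(mulr0, mul0r).
- move=> i j k /ltn_ord_eqF; case: (k =P i) => [->|]; last by rewrite mul0r !mulr0.
  by move=> ->; rewrite !(mulr0, mul0r).
- by move=> i j k l _ _; rewrite mulN1r [X in _ - X]mulrC subrr.
- move=> i j k l lt_ij lt_kl; rewrite mulN1r [X in _ - X]mulrC subrr.
  case: (i =P l) => [eil|]; last by rewrite mul0r mulr0.
  case: (j =P k) => [ejk|]; last by rewrite !mulr0.
  by move: lt_ij; rewrite eil ejk ltnNge (ltnW lt_kl).
- rewrite aexpr_eval_sum (bigD1 (1%g : 'S_3)) //= big1 => [|s s1].
    rewrite !perm1 !eqxx !mulr1 addr0.
    suff -> : perm_length (1%g : 'S_3) = 0%N by rewrite expr0.
    apply/eqP; rewrite cards_eq0; apply/eqP/setP=> -[a b]; rewrite !inE /= !perm1.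
    by case: ltngtP.
  have [h1|] := row1 =P s row1; last by rewrite !(mul0r, mulr0).
  have [h2|] := row2 =P s row2; last by rewrite !(mul0r, mulr0).
  have [h3|] := row3 =P s row3; last by rewrite !(mul0r, mulr0).
  case/eqP: s1; apply/permP=> -[[|[|[|//]]] lti]; rewrite perm1.
  + by rewrite (_ : Ordinal lti = row1) -?h1 //; apply: val_inj.
  + by rewrite (_ : Ordinal lti = row2) -?h2 //; apply: val_inj.
  + by rewrite (_ : Ordinal lti = row3) -?h3 //; apply: val_inj.
- move=> i j k1 k2 l1 l2 lt_k lt_l ek el.
  have ki : k1 != i /\ k2 != i.
    by split; move/setP: ek; [move/(_ k1)|move/(_ k2)];
      rewrite !inE eqxx ?orbT => <-.
  have lj : l1 != j /\ l2 != j.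
    by split; move/setP: el; [move/(_ l1)|move/(_ l2)];
      rewrite !inE eqxx ?orbT => <-.
  case: ki lj lt_k lt_l {ek el} => + + [].
  case: i => [[|[|[|//]]] ?]; case: j => [[|[|[|//]]] ?];
  case: k1 => [[|[|[|//]]] ?] //; case: k2 => [[|[|[|//]]] ?] //;
  case: l1 => [[|[|[|//]]] ?] //; case: l2 => [[|[|[|//]]] ?] // _ _ _ _ _ _;
  by rewrite -!val_eqE /= ?subrr ?expr0z !(mul0r, mulr0, mulr1, subr0, addr0).
Qed.

Definition SUq3_pres : presentation R[i] :=
  Presentation SUgen_starK SUgen_counit_star SUgen_counit_rel.
Definition SUq3 : Type := palg SUq3_pres.
HB.instance Definition _ := GRing.Algebra.on SUq3.

Definition star (a : SUq3) : SUq3 := palg_star a.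
Definition umat (i j : 'I_3) : SUq3 := pcls (P := SUq3_pres) (u i j).
Definition z (j : 'I_3) : SUq3 := umat row3 j.

End SUq3.

(* The right action of U_q(su(3)) on A(SU_q(3)).  It is determined by its     *)
(* values on the u^j_k, which generate A(SU_q(3)) as a *-algebra.             *)
Record Uq_action (R : realType) (q : R) (act : SUq3 q -> Uqsu3 q -> SUq3 q) :
    Prop := {
  act_linearl : forall h c a b, act (c *: a + b) h = c *: act a h + act b h;
  act_linearr : forall a c h k, act a (c *: h + k) = c *: act a h + act a k;
  act_1r : forall a, act a 1 = a;
  act_mulr : forall a h k, act a (h * k) = act (act a h) k;
  act_mull : forall a b h, act (a * b) (uclass q h) =
    \sum_(x <- coproduct h) act a (uclass q x.1) * act b (uclass q x.2);
  act_1l : forall h, act 1 h = counit h *: 1;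
  act_star : forall a h,
    star (act a (uclass q h)) = act (star a) (ustar (uclass q (antipode q h)));
  act_K : forall (i : 'I_2) (j k : 'I_3),
    act (umat q j k) (uK q i) =
    qhalf q ((j == i.+1 :> nat)%:Z - (j == i :> nat)%:Z) *: umat q j k;
  act_E : forall (i : 'I_2) (j k : 'I_3),
    act (umat q j k) (uE q i) =
    if j == i.+1 :> nat then umat q (inord i) k else 0;
  act_F : forall (i : 'I_2) (j k : 'I_3),
    act (umat q j k) (uF q i) =
    if j == i :> nat then umat q (inord i.+1) k else 0
}.

(* -------------------------------------------------------------------------- *)
(* The antiholomorphic calculus and the line bundles on CP^2_q.               *)
(* -------------------------------------------------------------------------- *)

Section Calculus.
Variables (R : realType) (q : R) (act : SUq3 q -> Uqsu3 q -> SUq3 q).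
Local Notation A := (SUq3 q).
Local Notation K1 := (uK q ord0).
Local Notation K2 := (uK q ord_max).
Local Notation E1 := (uE q ord0).
Local Notation F1 := (uF q ord0).
Local Notation F2 := (uF q ord_max).

Definition S5q (a : A) : Prop :=
  forall h, in_Uqsu2 h -> act a h = counit h *: a.

Definition line_bundle (N : int) (a : A) : Prop :=
  S5q a /\ act a (K1 * K2 ^+ 2) = qpow q N *: a.

Definition CP2q : A -> Prop := line_bundle 0.

(* Pairs (v_+, v_-) *)
Definition pair_act (v : A * A) (h : Uqsu3 q) : A * A := (act v.1 h, act v.2 h).
Definition pair_lmul (a : A) (v : A * A) : A * A := (a * v.1, a * v.2).
Definition pair_rmul (v : A * A) (a : A) : A * A := (v.1 * a, v.2 * a).

Definition Omega00 : A -> Prop := CP2q.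

Definition Omega01 (v : A * A) : Prop :=
  [/\ pair_act v (K1 * K2 ^+ 2) = qhalf q 3 *: v,
      pair_act v K1 = (qhalf q 1 *: v.1, qhalf q (-1) *: v.2),
      pair_act v F1 = (0, v.1) &
      pair_act v E1 = (v.2, 0)].

Definition Omega02 : A -> Prop := line_bundle 3.

Definition dbar0 (a : A) : A * A := (act a (F2 * F1), act a F2).

Definition dbar1 (v : A * A) : A :=
  act v.2 (F2 * F1) - (qnum q 2)%:C%C *: act v.1 F2.

Definition wedge (v w : A * A) : A :=
  qhalf q 1 *: (v.1 * w.2) - qhalf q (-1) *: (v.2 * w.1).

(* The adjoint of the component psi^N_(j,k,l) of Psi_N. *)
Definition psi_star (N : int) (j k l : nat) : A :=
  let m := z q row1 ^+ j * z q row2 ^+ k * z q row3 ^+ l in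
  let r := Num.sqrt (qmultinom q j k l) in
  if 0 <= N then r%:C%C *: m
  else (q ^ (- N + j%:Z - l%:Z) * r)%:C%C *: star m.

Definition psi (N : int) (j k l : nat) : A := star (psi_star N j k l).

(* q^-N Psi_N^dagger dbar(Psi_N xi), the components of Psi_N being indexed by *)
(* the triples t = (j, k, l) with j + k + l = |N|.                            *)
Definition nabla0 (N : int) (xi : A) : A * A :=
  qpow q (- N) *:
  \sum_(t : 'I_`|N|.+1 * 'I_`|N|.+1 * 'I_`|N|.+1 |
         (t.1.1 + t.1.2 + t.2)%N == `|N|%N)
     pair_lmul (psi_star N t.1.1 t.1.2 t.2) (dbar0 (psi N t.1.1 t.1.2 t.2 * xi)).

(* Omega^(0,1) (x) L_N, as its image in A^2 under multiplication. *)
Definition Omega01_line (N : int) (v : A * A) : Prop :=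
  exists (n : nat) (w : 'I_n -> A * A) (xi : 'I_n -> A),
    [/\ forall i, Omega01 (w i), forall i, line_bundle N (xi i) &
        v = \sum_i pair_rmul (w i) (xi i)].

(* D is the extension of nabla_N by the graded Leibniz rule                   *)
(* D (w (x) xi) = dbar w (x) xi - w . nabla_N xi                              *)
(* (this determines D on the image of Omega^(0,1) (x) L_N, where it matters). *)
(* Under the identification of Omega^(0,p) (x) L_N with its image, the product*)
(* w . (w' (x) xi') = (w . w') (x) xi' is given by the formula for [wedge].   *)
Definition is_nabla1 (N : int) (D : A * A -> A) : Prop :=
  forall (n : nat) (w : 'I_n -> A * A) (xi : 'I_n -> A),
    (forall i, Omega01 (w i)) -> (forall i, line_bundle N (xi i)) ->
    D (\sum_i pair_rmul (w i) (xi i)) =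
    \sum_i (dbar1 (w i) * xi i - wedge (w i) (nabla0 N (xi i))).

End Calculus.

(* Main.v *)
(* The elements z^J (z^J)^* (resp. (z^J)^* z^J), weighted by q-multinomial
   coefficients, sum to 1: by induction on |J|, starting from the unitarity of
   the third row of u (resp. the quantum determinant) and multiplying by the
   z_i on one side and by their adjoints on the other.  Hence
   Psi_N^dagger Psi_N = 1.  As F_2 kills the z_i, this gives
   Psi_N^dagger (Psi_N <| F_2) = 0, and nabla_N reduces on L_N to
   q^(-N/2) dbar.  By the coproduct formula, q^(-N/2) dbar on pairs satisfies
   the Leibniz rule that characterizes the extension of nabla_N, and the
   curvature is q^(-N) dbar^2, which vanishes by the Serre relation
   F_2^2 F_1 + F_1 F_2^2 = [2] F_2 F_1 F_2 since F_1 kills L_N.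
   The weight condition on L_N only fixes the square of K_2; that K_2 itself
   acts by q^(N/2) follows from the fact that A(SU_q(3)) is spanned by
   eigenvectors of K_2 with positive eigenvalues. *)

From mathcomp Require Import all_boot all_order all_algebra.
From mathcomp Require Import perm boolp reals complex ring zify.
(* Last, as [row1] is also the name of a lemma of matrix.v. *)
Require Import Defs.
Set Implicit Arguments.
Unset Strict Implicit.
Unset Printing Implicit Defensive.
Import Order.TTheory GRing.Theory Num.Theory.
Local Open Scope ring_scope.

(** * Operations, adjoint and character of a presented algebra, computed on classes of
    expressions *)

Section PresentedAlgebraTheory.
Variables (C : numClosedFieldType) (P : presentation C).
Implicit Types (a b : palg P) (s t : aexpr C (pgen P)).

Lemma pcls_add s t : pcls (P := P) (s + t)%X = pcls s + pcls t.
Proof. exact: pclsD. Qed.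

Lemma pcls_mul s t : pcls (P := P) (s * t)%X = pcls s * pcls t.
Proof. exact: pclsM. Qed.

Lemma pcls_scal c : pcls (P := P) (Scal c) = c *: 1.
Proof.
apply/esym; rewrite -[LHS](pclsZ (P := P) c 1%X); apply/pclsP.
exact: peqv_trans (peqv_sym (peqv_scalM _ c 1)) (eq_ind_r (fun x => peqv (Scal x) _)
  (peqv_refl (P := P) _) (mulr1 c)).
Qed.

Lemma pcls_sum (I : Type) (r : seq I) (Q : pred I) (G : I -> aexpr C (pgen P)) :
  pcls (P := P) (\big[Add/0%X]_(i <- r | Q i) G i) = \sum_(i <- r | Q i) pcls (G i).
Proof. by apply: (big_morph (@pcls C P)) => // s t; apply: pcls_add. Qed.

(** Turns a defining relation between expressions into an identity in the algebra, scalar factors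
    becoming [*:]. *)
Definition pclsE := (pcls_add, pcls_mul, pcls_scal, mulr_algl, mulr_algr, pcls_sum).

Lemma pcls_rel s t : prel s t -> pcls (P := P) s = pcls t.
Proof. by move=> st; apply/pclsP/peqv_rel. Qed.

Lemma pcls_rel_star s t : prel s t ->
  pcls (P := P) (aexpr_star (@pstar C P) s) = pcls (aexpr_star (@pstar C P) t).
Proof. by move=> st; apply/pclsP/peqv_rel_star. Qed.

Lemma palg_starM a b : palg_star (a * b) = palg_star b * palg_star a.
Proof.
elim/pcls_ind: a => s; elim/pcls_ind: b => t.
by rewrite -pcls_mul !palg_star_cls -pcls_mul.
Qed.

Lemma palg_starZ c a : palg_star (c *: a) = c^* *: palg_star a.
Proof.
elim/pcls_ind: a => s.
by rewrite -[c *: _]mulr_algl -pcls_scal -pcls_mul !palg_star_cls !pclsE.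
Qed.

Lemma palg_star1 : palg_star (1 : palg P) = 1.
Proof. by rewrite palg_star_cls /= rmorph1. Qed.

Lemma palg_starK : involutive (@palg_star C P).
Proof. by elim/pcls_ind => s; rewrite !palg_star_cls aexpr_starK. Qed.

Lemma palg_augD a b : palg_aug (a + b) = palg_aug a + palg_aug b.
Proof.
elim/pcls_ind: a => s; elim/pcls_ind: b => t.
by rewrite -pcls_add !palg_aug_cls.
Qed.

Lemma palg_augM a b : palg_aug (a * b) = palg_aug a * palg_aug b.
Proof.
elim/pcls_ind: a => s; elim/pcls_ind: b => t.
by rewrite -pcls_mul !palg_aug_cls.
Qed.

Lemma palg_augZ c a : palg_aug (c *: a) = c * palg_aug a.
Proof.
elim/pcls_ind: a => s.
by rewrite -[c *: _]mulr_algl -pcls_scal -pcls_mul !palg_aug_cls.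
Qed.

Lemma palg_aug1 : palg_aug (1 : palg P) = 1.
Proof. by rewrite palg_aug_cls. Qed.

End PresentedAlgebraTheory.

(** * q-numbers and the Pascal rule for q-multinomial coefficients *)

Section QNumberTheory.
Variables (R : realType) (q : R).
Hypotheses (q_gt0 : 0 < q) (q_lt1 : q < 1).

Let q_neq0 : q != 0. Proof. by rewrite gt_eqF. Qed.
Let qq1_neq0 : q * q - 1 != 0.
Proof. by rewrite subr_eq0 lt_eqF // mulr_ilt1 // ltW. Qed.

Lemma qnum_gt0 n : (0 < n)%N -> 0 < qnum q n%:Z.
Proof.
have lt_qV m : (0 < m)%N -> q ^+ m < q ^- m.
  move=> m_gt0; have qm1 : q ^+ m < 1 by rewrite exprn_ilt1 ?ltW // -lt0n.
  by rewrite (lt_trans qm1) // invf_gt1 ?exprn_gt0.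
move=> /lt_qV qn; rewrite /qnum -exprnN -exprnP nmulr_rgt0 ?subr_lt0 //.
by rewrite invr_lt0 subr_lt0 (lt_qV 1%N).
Qed.

Lemma qnum2 : qnum q 2 = q + q^-1.
Proof.
by rewrite /qnum -exprnN -exprnP; field; rewrite q_neq0 qq1_neq0.
Qed.

Lemma qfactS n : qfact q n.+1 = qfact q n * qnum q n.+1.
Proof. by rewrite /qfact big_nat_recr. Qed.

Lemma qfact_gt0 n : 0 < qfact q n.
Proof.
elim: n => [|n IHn]; first by rewrite /qfact big_nil.
by rewrite qfactS mulr_gt0 // qnum_gt0.
Qed.

Lemma qmultinom_gt0 j k l : 0 < qmultinom q j k l.
Proof. by rewrite mulr_gt0 ?invr_gt0 ?exprn_gt0 ?divr_gt0 ?mulr_gt0 ?qfact_gt0. Qed.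

Lemma qmultinom0 : qmultinom q 0 0 0 = 1.
Proof.
have f0 : qfact q 0 = 1 by rewrite /qfact big_geq.
by rewrite /qmultinom !f0 !mulr1 !invr1 !mulr1.
Qed.

Lemma qmultinomC12 j k l : qmultinom q j k l = qmultinom q k j l.
Proof.
rewrite /qmultinom [(j + k)%N]addnC [(j * k)%N]mulnC (mulnC k l) (mulnC l j).
by rewrite addnAC (mulrC (qfact q j)).
Qed.

Lemma qmultinomC23 j k l : qmultinom q j k l = qmultinom q j l k.
Proof.
have e : (j * k + k * l + l * j = j * l + l * k + k * j)%N by clear; lia.
by rewrite /qmultinom e (addnAC j k l) (mulrAC (qfact q j)).
Qed.

Lemma qmultinom_rev j k l : qmultinom q j k l = qmultinom q l k j.
Proof. by rewrite (qmultinomC12 j) (qmultinomC23 k) (qmultinomC12 k). Qed.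

(** Raising [j] by one adds [k + l] to the exponent jk + kl + lj and one factor to each of the two
    q-factorials that involve [j]. *)
Lemma qmultinomS j k l :
  qmultinom q j.+1 k l * qnum q j.+1 =
  q ^- (k + l) * qmultinom q j k l * qnum q (j + k + l).+1.
Proof.
have -> : qmultinom q j.+1 k l = q ^- (k + l + (j * k + k * l + l * j)) *
    (qfact q (j + k + l).+1 / (qfact q j.+1 * qfact q k * qfact q l)).
  by rewrite /qmultinom; congr (_ ^- _ * _); lia.
rewrite /qmultinom exprD !qfactS; field.
by rewrite !expf_neq0 // !gt_eqF ?qfact_gt0 ?qnum_gt0.
Qed.

Lemma qnum_add3 j k l :
  qnum q (j + k + l)%N =
  q ^+ (k + l) * qnum q j + q ^+ l * q ^- j * qnum q k + q ^- (j + k) * qnum q l.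
Proof.
rewrite /qnum -!exprnN -!exprnP !exprD; field.
by rewrite !expf_neq0 // qq1_neq0 q_neq0.
Qed.

(** After multiplication by [j+k+l], [qnum_add3] splits the left side into three terms, and
    [qmultinomS] identifies each with one term on the right. *)
Lemma qmultinom_rec j k l : (0 < j + k + l)%N ->
  qmultinom q j k l =
  (if j is j'.+1 then qmultinom q j' k l else 0) +
  (if k is k'.+1 then q ^- j.*2 * qmultinom q j k' l else 0) +
  (if l is l'.+1 then q ^- (j + k).*2 * qmultinom q j k l' else 0).
Proof.
move=> n_gt0; have n_neq0 : qnum q (j + k + l)%N != 0 by rewrite gt_eqF ?qnum_gt0.
have qn m : q ^+ m != 0 by rewrite expf_neq0.
have q0 : qnum q 0 = 0 by rewrite /qnum oppr0 subrr mul0r.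
apply: (mulIf n_neq0); rewrite !mulrDl {1}qnum_add3 !mulrDr.
(* For [a = 0] the default value 0 is consistent with [0] = 0. *)
have pred1 a b c : (if a is a'.+1 then qmultinom q a' b c else 0) * qnum q (a + b + c)%N =
    q ^+ (b + c) * (qmultinom q a b c * qnum q a).
  case: a => [|a]; first by rewrite q0 mul0r !mulr0.
  by rewrite qmultinomS !addSn -[q ^- _ * _ * _]mulrA mulVKf.
congr (_ + _ + _).
- by rewrite pred1 mulrCA.
(* The symmetry of the coefficient brings [k] to the first place, where [pred1] applies; the last
   case does the same with [l]. *)
- transitivity (q ^- j.*2 * (q ^+ (j + l) * (qmultinom q k j l * qnum q k))).
    rewrite qmultinomC12 -addnn !exprD; field; exact: qn.
  rewrite -pred1 (addnC k); case: k {n_gt0 n_neq0} => [|k]; first by rewrite !mul0r mulr0.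
  by rewrite mulrA (qmultinomC12 k).
- transitivity (q ^- (j + k).*2 * (q ^+ (j + k) * (qmultinom q l j k * qnum q l))).
    rewrite (qmultinomC12 l) (qmultinomC23 j l) -addnn !exprD; field.
    by rewrite !qn.
  rewrite -pred1 -addnA (addnC l); case: l {n_gt0 n_neq0} => [|l]; first by rewrite !mul0r mulr0.
  by rewrite mulrA (qmultinomC12 l) (qmultinomC23 j l).
Qed.
End QNumberTheory.

(** * Sums over triples of given total, and their behaviour under a shift of one index *)

Section BoxSum.
Variable V : nmodType.

(** The bound [B] of the box is independent of the total [n], so that an induction on [n] can keep
    the box fixed; outside the plane j + k + l = n the summand is 0. *)
Definition boxsum (B n : nat) (G : nat -> nat -> nat -> V) : V :=
  \sum_(j < B.+1) \sum_(k < B.+1) \sum_(l < B.+1)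
     if (j + k + l == n)%N then G j k l else 0.

Lemma boxsumE B n G :
  boxsum B n G =
  \sum_(t : 'I_B.+1 * 'I_B.+1 * 'I_B.+1 | (t.1.1 + t.1.2 + t.2 == n)%N)
     G t.1.1 t.1.2 t.2.
Proof.
rewrite [RHS]big_mkcond /= -(pair_bigA _ (fun (p : 'I_B.+1 * 'I_B.+1) (l : 'I_B.+1) =>
  if (p.1 + p.2 + l == n)%N then G p.1 p.2 l else 0)) /=.
by rewrite -(pair_bigA _ (fun j k : 'I_B.+1 =>
  \sum_(l < B.+1) if (j + k + l == n)%N then G j k l else 0)).
Qed.

Lemma eq_boxsum B n G G' :
  (forall j k l, (j + k + l)%N = n -> G j k l = G' j k l) ->
  boxsum B n G = boxsum B n G'.
Proof.
move=> eqG; do 3!apply: eq_bigr => ? _.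
by case: eqP => // /eqG.
Qed.

Lemma boxsumD B n G G' :
  boxsum B n (fun j k l => G j k l + G' j k l) = boxsum B n G + boxsum B n G'.
Proof.
rewrite /boxsum -big_split; apply: eq_bigr => j _.
rewrite -big_split; apply: eq_bigr => k _.
rewrite -big_split; apply: eq_bigr => l _ /=.
by case: ifP => //; rewrite addr0.
Qed.

Lemma boxsum0 B G : boxsum B 0 G = G 0 0 0.
Proof.
rewrite /boxsum big_ord_recl [X in _ + X]big1 ?addr0 => [|j _]; last first.
  by do 2!apply: big1 => ? _.
rewrite big_ord_recl [X in _ + X]big1 ?addr0 => [|k _]; last by apply: big1.
by rewrite big_ord_recl [X in _ + X]big1 ?addr0.
Qed.

Let shift B F : F B = 0 ->
  \sum_(j < B.+1) (if j : nat is j'.+1 then F j' else 0) = \sum_(j < B.+1) F j :> V.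
Proof. by move=> FB; rewrite big_ord_recl [RHS]big_ord_recr /= FB add0r addr0. Qed.

(** Since n < B, no triple of total [n] has an index equal to [B], so the shift loses no term at the
    upper face of the box. *)
Lemma boxsum_shift1 B n G : (n < B)%N ->
  boxsum B n.+1 (fun j k l => if j is j'.+1 then G j' k l else 0) = boxsum B n G.
Proof.
move=> ltnB; rewrite /boxsum -(@shift _ (fun j => \sum_(k < _) \sum_(l < _)
  if (j + k + l == n)%N then G j k l else 0)).
  apply: eq_bigr => -[[|j] /= _] _ //.
  by rewrite big1 // => k _; rewrite big1 // => l _; rewrite if_same.
by rewrite big1 // => k _; rewrite big1 // => l _; case: eqP => //; lia.
Qed.

Lemma boxsum_shift2 B n G : (n < B)%N ->
  boxsum B n.+1 (fun j k l => if k is k'.+1 then G j k' l else 0) = boxsum B n G.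
Proof.
move=> ltnB; apply: eq_bigr => j _; rewrite -(@shift _ (fun k => \sum_(l < _)
  if (j + k + l == n)%N then G j k l else 0)).
  apply: eq_bigr => -[[|k] /= _] _; last by rewrite addnS.
  by rewrite big1 // => l _; rewrite if_same.
by rewrite big1 // => l _; case: eqP => //; lia.
Qed.

Lemma boxsum_shift3 B n G : (n < B)%N ->
  boxsum B n.+1 (fun j k l => if l is l'.+1 then G j k l' else 0) = boxsum B n G.
Proof.
move=> ltnB; apply: eq_bigr => j _; apply: eq_bigr => k _.
rewrite -(@shift _ (fun l => if (j + k + l == n)%N then G j k l else 0)).
  by apply: eq_bigr => -[[|l] /= _] _; [rewrite if_same | rewrite addnS].
by case: eqP => //; lia.
Qed.

End BoxSum.

(** * Expansion of powers of a sum of three operators that move along a family indexed by triples *)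

Section TrinomialExpansion.
Variables (C : comPzRingType) (V : lmodType C) (L1 L2 L3 : {linear V -> V}).
Variables (M : nat -> nat -> nat -> V) (c s1 s2 s3 : nat -> nat -> nat -> C).
Hypothesis M1 : forall j k l, L1 (M j k l) = s1 j k l *: M j.+1 k l.
Hypothesis M2 : forall j k l, L2 (M j k l) = s2 j k l *: M j k.+1 l.
Hypothesis M3 : forall j k l, L3 (M j k l) = s3 j k l *: M j k l.+1.
Hypothesis c0 : c 0 0 0 = 1.
Hypothesis cS : forall j k l, (0 < j + k + l)%N ->
  c j k l = (if j is j'.+1 then s1 j' k l * c j' k l else 0) +
            (if k is k'.+1 then s2 j k' l * c j k' l else 0) +
            (if l is l'.+1 then s3 j k l' * c j k l' else 0).

Lemma linear_boxsum (L : {linear V -> V}) B n G :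
  L (boxsum B n G) = boxsum B n (fun j k l => L (G j k l)).
Proof.
rewrite /boxsum !linear_sum; apply: eq_bigr => j _.
rewrite linear_sum; apply: eq_bigr => k _.
rewrite linear_sum; apply: eq_bigr => l _.
by case: ifP; rewrite ?linear0.
Qed.

(** The sum on the left is the n-th power of L1 + L2 + L3 applied to [M 0 0 0]: the recursion for
    [c] collects the three ways of reaching [M j k l]. A fixed vector of L1 + L2 + L3 is fixed by
    all its powers. *)
Lemma boxsum_fixpoint B n :
  L1 (M 0 0 0) + L2 (M 0 0 0) + L3 (M 0 0 0) = M 0 0 0 -> (n <= B)%N ->
  boxsum B n (fun j k l => c j k l *: M j k l) = M 0 0 0.
Proof.
move=> LM; elim: n => [|n IHn] le_nB; first by rewrite boxsum0 c0 scale1r.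
have IH := IHn (ltnW le_nB).
(* One more application of L1 + L2 + L3, the vector [M 0 0 0] under it being replaced by its
   expansion in degree [n]. *)
rewrite -[RHS]LM -IH !linear_boxsum.
rewrite -(boxsum_shift1 _ le_nB) -(boxsum_shift2 _ le_nB) -(boxsum_shift3 _ le_nB).
rewrite -!boxsumD; apply: eq_boxsum => j k l jkl; rewrite cS ?jkl // !scalerDl.
congr (_ + _ + _).
- by case: j {jkl} => [|j]; rewrite ?scale0r // linearZ /= M1 scalerA mulrC.
- by case: k {jkl} => [|k]; rewrite ?scale0r // linearZ /= M2 scalerA mulrC.
- by case: l {jkl} => [|l]; rewrite ?scale0r // linearZ /= M3 scalerA mulrC.
Qed.

End TrinomialExpansion.

(** * Explicit enumeration of the six permutations and of their inversions *)

Section SumOverS3.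
Let s12 := tperm row1 row2.
Let s23 := tperm row2 row3.
Let s13 := tperm row1 row3.
Let S3 : seq 'S_3 := [:: 1%g; s23; s12; (s23 * s12)%g; (s12 * s23)%g; s13].

Lemma sum_S3 (V : nmodType) (F : 'S_3 -> V) :
  \sum_s F s = \sum_(s <- S3) F s.
Proof.
(* The values at two points distinguish the listed permutations; being 3! in number, they exhaust
   the group. *)
have uS : uniq S3.
  apply: (@map_uniq _ _ (fun s : 'S_3 => (val (s row1), val (s row2)))).
  by rewrite /= /s12 /s23 /s13 !permE /= !permE /=.
apply: perm_big; apply: uniq_perm; rewrite ?index_enum_uniq //.
have [|_ eS] := uniq_min_size uS (s2 := index_enum _) (fun s _ => mem_index_enum s).
  by rewrite /index_enum -enumT -cardE card_Sn.
by move=> s; rewrite eS.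
Qed.

Lemma perm_lengthE (s : 'S_3) :
  perm_length s = ((s row2 < s row1) + (s row3 < s row1) + (s row3 < s row2))%N.
Proof.
rewrite /perm_length -sum1_card big_mkcond /=.
under eq_bigr => p _ do rewrite inE.
rewrite -(pair_bigA _ (fun i j : 'I_3 =>
  if (i < j)%N && (s j < s i)%N then 1%N else 0%N)) /=.
do !rewrite big_ord_recl /=; rewrite !big_ord0 /=.
have -> : ord0 = row1 by apply: val_inj.
have -> : lift row1 ord0 = row2 :> 'I_3 by apply: val_inj.
have -> : lift row1 (lift ord0 ord0) = row3 :> 'I_3 by apply: val_inj.
by do 3!case: ifP => //= _.
Qed.

End SumOverS3.

(** * Quantum Laplace expansion along the third row, with the entries on either side of the
    minors *)

Section MinorExpansion.
Variables (C : fieldType) (A : algType C) (Q L : C).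
Variables (a b c d e f g h k : A).
Hypotheses (Q_neq0 : Q != 0) (LE : L = Q - Q^-1).
Hypotheses (gb : g * b = b * g) (gc : g * c = c * g) (ge : g * e = e * g) (gf : g * f = f * g).
Hypotheses (hc : h * c = c * h) (hf : h * f = f * h).
Hypotheses (ha : h * a = a * h - L *: (b * g)) (hd : h * d = d * h - L *: (e * g)).
Hypotheses (ka : k * a = a * k - L *: (c * g)) (kb : k * b = b * k - L *: (c * h)).
Hypotheses (kd : k * d = d * k - L *: (f * g)) (ke : k * e = e * k - L *: (f * h)).
(** The 2 x 2 quantum minors of the first two rows of the matrix with rows a b c, d e f and g h k;
    the index is that of the omitted column. *)
Let A1 := b * f - Q *: (c * e).
Let A2 := a * f - Q *: (c * d).
Let A3 := a * e - Q *: (b * d).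

Let gA : g * A1 = A1 * g.
Proof.
by rewrite /A1 mulrBr mulrBl -scalerAr -scalerAl !mulrA gb gc -!mulrA gf ge.
Qed.

Let hA : h * A2 = A2 * h - L *: (A1 * g).
Proof.
rewrite /A2 /A1 mulrBr -scalerAr !mulrA ha hc !mulrBl -!scalerAl -!mulrA hf gf hd.
rewrite !mulrBr !scalerBr !scalerA -!scalerAr !scalerA (mulrC Q).
by rewrite !opprB !addrA [LHS](ACl (1*4*3*2)).
Qed.

Let kA : k * A3 = A3 * k - L *: (A2 * h) + (L * Q) *: (A1 * g).
Proof.
rewrite /A3 /A2 /A1 mulrBr -scalerAr !mulrA ka kb !mulrBl -!scalerAl -!mulrA hd kd ke ge.
rewrite !mulrBr !scalerBr -!scalerAr !scalerA !opprB !addrA.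
(* Splits the coefficient of [c * e * g] in the right side into the two contributions that occur on
   the left. *)
have -> : L * Q * Q = L + Q * L * L by rewrite LE; field.
rewrite scalerDl opprD !addrA (mulrC Q).
by rewrite [LHS](ACl (1*7*4*2*6*3*5)).
Qed.

(** Moving [g], [h], [k] to the right of the minors creates corrections in [A2 * h] and [A1 * g]
    only. They turn the coefficients Q^-1 and Q^-2 into Q and Q^2, as Q = Q^-1 + L and Q^2 = Q^-2 +
    Q^-1 L + L Q. *)
Lemma minor_expansion_row3 :
  Q ^- 2 *: (g * A1) - Q^-1 *: (h * A2) + k * A3 =
  A3 * k - Q *: (A2 * h) + Q ^+ 2 *: (A1 * g).
Proof.
have -> : Q ^+ 2 *: (A1 * g) =
    Q ^- 2 *: (A1 * g) + (Q^-1 * L) *: (A1 * g) + (L * Q) *: (A1 * g).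
  by rewrite -!scalerDl; congr (_ *: _); rewrite LE; field.
have -> : Q *: (A2 * h) = Q^-1 *: (A2 * h) + L *: (A2 * h).
  by rewrite -scalerDl; congr (_ *: _); rewrite LE; field.
rewrite gA hA kA !scalerBr !opprD !scalerA opprK !addrA.
by rewrite [LHS](ACl (4*2*5*1*3*6)).
Qed.
End MinorExpansion.

(** * Relations of the quantum group and the two sphere relations for its third row *)

Section SUq3Theory.
Variables (R : realType) (q : R).
Hypothesis q_gt0 : 0 < q.
Local Notation A := (SUq3 q).
Local Notation u := (umat q).
Local Notation Q := (q%:C%C : R[i]).
Local Notation zz := (z q).
Implicit Types (a b : A).

Let q_neq0 : q != 0. Proof. by rewrite gt_eqF. Qed.

Lemma qpowE n : qpow q n = Q ^ n.
Proof. exact: (fmorphXz (real_complex R)). Qed.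

Lemma Q_neq0 : Q != 0.
Proof. by rewrite fmorph_eq0. Qed.

Lemma conjC_real (x : R) : (x%:C%C : R[i])^* = x%:C%C.
Proof. by apply: conj_Creal; rewrite complex_real. Qed.

Lemma starM a b : star (a * b) = star b * star a.
Proof. exact: palg_starM. Qed.

Lemma starZ c a : star (c *: a) = c^* *: star a.
Proof. exact: palg_starZ. Qed.

Lemma star1 : star (1 : A) = 1.
Proof. exact: palg_star1. Qed.

Lemma starK a : star (star a) = a.
Proof. exact: palg_starK. Qed.

Lemma star0 : star (0 : A) = 0.
Proof. by have := starZ 0 0; rewrite rmorph0 !scale0r. Qed.

Lemma umat_row (i j k : 'I_3) : (i < j)%N -> u k i * u k j = Q *: (u k j * u k i).
Proof.
move=> lt_ij; have := pcls_rel (P := SUq3_pres q) (SU_rel_row q k lt_ij).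
by rewrite !pclsE qpowE.
Qed.

Lemma umat_comm (i j k l : 'I_3) : (i < j)%N -> (k < l)%N ->
  u i l * u j k = u j k * u i l.
Proof.
move=> lt_ij lt_kl; have := pcls_rel (P := SUq3_pres q) (SU_rel_comm q lt_ij lt_kl).
by rewrite !pclsE scaleN1r scale0r => /eqP; rewrite subr_eq0 => /eqP.
Qed.

Lemma umat_cross (i j k l : 'I_3) : (i < j)%N -> (k < l)%N ->
  u j l * u i k = u i k * u j l - (Q - Q^-1) *: (u i l * u j k).
Proof.
move=> lt_ij lt_kl; have := pcls_rel (P := SUq3_pres q) (SU_rel_cross q lt_ij lt_kl).
by rewrite !pclsE scaleN1r !qpowE => <-; rewrite opprB addrC subrK.
Qed.

Definition minor (k1 k2 l1 l2 : 'I_3) : A := u k1 l1 * u k2 l2 - Q *: (u k1 l2 * u k2 l1).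

Lemma star_umat (i j k1 k2 l1 l2 : 'I_3) : (k1 < k2)%N -> (l1 < l2)%N ->
  [set k1; k2] = [set~ i] -> [set l1; l2] = [set~ j] ->
  star (u i j) = (- Q) ^ (j%:Z - i%:Z) *: minor k1 k2 l1 l2.
Proof.
move=> lk ll ek el; have := pcls_rel (P := SUq3_pres q) (SU_rel_star q lk ll ek el).
by rewrite !pclsE scaleN1r !qpowE /star palg_star_cls.
Qed.

(** The six terms of the quantum determinant, grouped by the column in which the third row is
    used. *)
Lemma qdet :
  minor row1 row2 row1 row2 * u row3 row3 -
  Q *: (minor row1 row2 row1 row3 * u row3 row2) +
  Q ^+ 2 *: (minor row1 row2 row2 row3 * u row3 row1) = 1.
Proof.
have := pcls_rel (P := SUq3_pres q) (SU_rel_det q).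
rewrite pcls_sum sum_S3 !big_cons big_nil.
rewrite !perm_lengthE !permE /= !permE /=.
rewrite !pclsE scale1r !(addn0, add0n, addn1) qpowE expr0 scale1r => <-.
rewrite /minor !mulrBl !scalerBr -!scalerAl !scalerA -/(umat q _ _) opprB addr0 !addrA.
rewrite [LHS](ACl (1*4*2*5*3*6)) /umat -!scaleNr.
by congr (_ + _ *: _ + _ *: _ + _ *: _ + _ *: _ + _ *: _); rewrite expr1z; ring.
Qed.
Lemma star_umat_row3 :
  [/\ star (zz row1) = Q ^- 2 *: minor row1 row2 row2 row3,
      star (zz row2) = - Q^-1 *: minor row1 row2 row1 row3 &
      star (zz row3) = minor row1 row2 row1 row2].
Proof.
have neq (i j k : 'I_3) : val i != val j -> val i != val k -> val j != val k ->
    [set j; k] = [set~ i].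
  case: i j k => [[|[|[|//]]] ?] [[|[|[|//]]] ?] [[|[|[|//]]] ?] //= _ _ _;
  by apply/setP => -[[|[|[|//]]] ?]; rewrite !inE -!val_eqE.
rewrite /z (@star_umat row3 row1 row1 row2 row2 row3) //; do ?exact: neq.
rewrite (@star_umat row3 row2 row1 row2 row1 row3) //; do ?exact: neq.
rewrite (@star_umat row3 row3 row1 row2 row1 row2) //; do ?exact: neq.
split; last by rewrite scale1r.
  by rewrite -[_ - _]/(- 2%:Z) -exprnN sqrrN.
by rewrite -[_ - _]/(- 1%:Z) -exprnN expr1 invrN.
Qed.

(** The weights Q^4, Q^2, 1 turn the coefficients Q^-2, -Q^-1, 1 of the minors in [star_umat_row3]
    into those of [qdet]. *)
Lemma z_star_z :
  Q ^+ 4 *: (star (zz row1) * zz row1) + Q ^+ 2 *: (star (zz row2) * zz row2)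
    + star (zz row3) * zz row3 = 1.
Proof.
have [-> -> ->] := star_umat_row3; rewrite -qdet -!scalerAl !scalerA -scaleNr.
rewrite [RHS](ACl (3*2*1)); congr (_ *: _ + _ *: _ + _); field; exact: Q_neq0.
Qed.

(** With the entries on the left, the coefficients in [star_umat_row3] are already those of the left
    side of [minor_expansion_row3]. *)
Lemma z_z_star :
  zz row1 * star (zz row1) + zz row2 * star (zz row2) + zz row3 * star (zz row3) = 1.
Proof.
have [-> -> ->] := star_umat_row3; rewrite -qdet -!scalerAr scaleNr /minor /z.
apply: (minor_expansion_row3 Q_neq0 (erefl (Q - Q^-1)));
  by [apply/esym/umat_comm | apply: umat_comm | apply: umat_cross].
Qed.

(** * Ordered monomials in the z_i and the two partitions of unity they give *)

Lemma qcommXl a b (c : R[i]) n :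
  a * b = c *: (b * a) -> a ^+ n * b = c ^+ n *: (b * a ^+ n).
Proof.
move=> ab; elim: n => [|n IHn]; first by rewrite !expr0 scale1r mul1r mulr1.
by rewrite exprSr -mulrA ab -scalerAr [a ^+ n * (b * _)]mulrA IHn -scalerAl scalerA -exprS -mulrA.
Qed.

Lemma qcommXr a b (c : R[i]) n :
  a * b = c *: (b * a) -> a * b ^+ n = c ^+ n *: (b ^+ n * a).
Proof.
move=> ab; elim: n => [|n IHn]; first by rewrite !expr0 scale1r mul1r mulr1.
by rewrite exprSr mulrA IHn -scalerAl -[b ^+ n * a * b]mulrA ab -scalerAr scalerA mulrA -!exprSr.
Qed.

Definition zmono j k l : A := zz row1 ^+ j * zz row2 ^+ k * zz row3 ^+ l.

Lemma z_qcomm (i j : 'I_3) : (i < j)%N -> zz j * zz i = Q^-1 *: (zz i * zz j).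
Proof. by move=> lt_ij; rewrite [zz i * _]umat_row // scalerA mulVf ?scale1r ?Q_neq0. Qed.

Lemma z1_zmono j k l : zz row1 * zmono j k l = zmono j.+1 k l.
Proof. by rewrite /zmono !mulrA -exprS. Qed.

Lemma z2_zmono j k l : zz row2 * zmono j k l = Q ^- j *: zmono j k.+1 l.
Proof.
rewrite /zmono !mulrA (qcommXr _ (z_qcomm (i := row1) (j := row2) isT)).
by rewrite -!scalerAl exprVn -(mulrA _ (zz row2)) -exprS.
Qed.

Lemma z3_zmono j k l : zz row3 * zmono j k l = Q ^- (j + k) *: zmono j k l.+1.
Proof.
rewrite /zmono !mulrA (qcommXr _ (z_qcomm (i := row1) (j := row3) isT)).
rewrite -!scalerAl -(mulrA _ (zz row3)) (qcommXr _ (z_qcomm (i := row2) (j := row3) isT)).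
by rewrite -scalerAr -scalerAl scalerA !exprVn -invfM -exprD mulrA -(mulrA _ (zz row3)) -exprS.
Qed.

Lemma zmono_z3 j k l : zmono j k l * zz row3 = zmono j k l.+1.
Proof. by rewrite /zmono -mulrA -exprSr. Qed.

Lemma zmono_z2 j k l : zmono j k l * zz row2 = Q ^- l *: zmono j k.+1 l.
Proof.
rewrite /zmono -mulrA (qcommXl _ (z_qcomm (i := row2) (j := row3) isT)).
by rewrite -scalerAr exprVn mulrA -(mulrA _ _ (zz row2)) -exprSr.
Qed.

Lemma zmono_z1 j k l : zmono j k l * zz row1 = Q ^- (k + l) *: zmono j.+1 k l.
Proof.
rewrite /zmono -mulrA (qcommXl _ (z_qcomm (i := row1) (j := row3) isT)).
rewrite -scalerAr mulrA -(mulrA _ _ (zz row1)) (qcommXl _ (z_qcomm (i := row1) (j := row2) isT)).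
by rewrite -scalerAr -scalerAl scalerA !exprVn -invfM -exprD mulrA -exprSr addnC.
Qed.

Lemma conj_QVX n : (Q ^- n)^* = Q ^- n.
Proof. by rewrite fmorphV rmorphXn /= conjC_real. Qed.

Lemma qmultinomC_rec j k l : q < 1 -> (0 < j + k + l)%N ->
  (qmultinom q j k l)%:C%C =
  (if j is j'.+1 then 1 * (qmultinom q j' k l)%:C%C else 0) +
  (if k is k'.+1 then Q ^- j.*2 * (qmultinom q j k' l)%:C%C else 0) +
  (if l is l'.+1 then Q ^- (j + k).*2 * (qmultinom q j k l')%:C%C else 0) :> R[i].
Proof.
move=> q_lt1 n_gt0; rewrite (qmultinom_rec q_gt0 q_lt1 n_gt0) !rmorphD /=.
by case: j {n_gt0} => [|j]; case: k => [|k]; case: l => [|l];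
  rewrite ?rmorph0 ?mul1r ?rmorphM /= ?fmorphV ?rmorphXn.
Qed.

Lemma zmono_partition B n : q < 1 -> (n <= B)%N ->
  boxsum B n (fun j k l => (qmultinom q j k l)%:C%C *: (zmono j k l * star (zmono j k l))) = 1.
Proof.
move=> q_lt1 le_nB.
(* Multiplication by z_i on the left and by its adjoint on the right; the sum of the three operators
   fixes 1 by [z_z_star]. *)
pose conjz (i : 'I_3) : {linear A -> A} := star (zz i) \o* (zz i \*o idfun).
have conjzE i a : conjz i (a * star a) = (zz i * a) * star (zz i * a).
  by rewrite /= starM !mulrA.
have M0 : zmono 0 0 0 * star (zmono 0 0 0) = 1.
  by rewrite /zmono !expr0 !mulr1 star1 mulr1.
rewrite (@boxsum_fixpoint _ _ (conjz row1) (conjz row2) (conjz row3)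
  (fun j k l => zmono j k l * star (zmono j k l)) _
  (fun _ _ _ => 1) (fun j _ _ => Q ^- j.*2) (fun j k _ => Q ^- (j + k).*2)) //.
- move=> j k l; by rewrite conjzE z1_zmono scale1r.
- move=> j k l; rewrite conjzE z2_zmono starZ conj_QVX -scalerAr -scalerAl scalerA.
  by rewrite -invfM -exprD addnn.
- move=> j k l; rewrite conjzE z3_zmono starZ conj_QVX -scalerAr -scalerAl scalerA.
  by rewrite -invfM -exprD addnn.
- by rewrite qmultinom0.
- by move=> j k l; apply: qmultinomC_rec.
- by rewrite M0 /= !mulr1 z_z_star.
Qed.

(** The mirror image of [zmono_partition]: [z_star_z] puts the scalars Q^4 and Q^2 on the operators
    for z_1 and z_2, and these accumulate to the weight Q^(2(2j+k)). *)
Lemma star_zmono_partition B n : q < 1 -> (n <= B)%N ->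
  boxsum B n (fun j k l => (qmultinom q j k l)%:C%C *:
    (Q ^+ (j.*2 + k).*2 *: (star (zmono j k l) * zmono j k l))) = 1.
Proof.
move=> q_lt1 le_nB.
pose conjz (i : 'I_3) : {linear A -> A} :=
  Q ^+ (2 - i).*2 \*: (zz i \o* (star (zz i) \*o idfun)).
have conjzE i c a : conjz i (c *: (star a * a)) =
    (Q ^+ (2 - i).*2 * c) *: (star (a * zz i) * (a * zz i)).
  by rewrite /= starM -scalerAr -scalerAl scalerA !mulrA.
have M0 : star (zmono 0 0 0) * zmono 0 0 0 = 1.
  by rewrite /zmono !expr0 !mulr1 star1.
rewrite (@boxsum_fixpoint _ _ (conjz row1) (conjz row2) (conjz row3)
  (fun j k l => Q ^+ (j.*2 + k).*2 *: (star (zmono j k l) * zmono j k l)) _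
  (fun _ k l => Q ^- (k + l).*2) (fun _ _ l => Q ^- l.*2) (fun _ _ _ => 1)) // ?M0 ?scale1r //.
- move=> j k l; rewrite conjzE zmono_z1 starZ conj_QVX -scalerAr -scalerAl !scalerA.
  by congr (_ *: _); rewrite -!addnn !(exprD, exprS) expr0; field; rewrite !expf_neq0 ?Q_neq0.
- move=> j k l; rewrite conjzE zmono_z2 starZ conj_QVX -scalerAr -scalerAl !scalerA.
  by congr (_ *: _); rewrite -!addnn !(exprD, exprS) expr0; field; rewrite !expf_neq0 ?Q_neq0.
- move=> j k l; by rewrite conjzE zmono_z3 scale1r mul1r.
- by rewrite qmultinom0.
(* Factors are now appended on the right of the monomial, so the Pascal rule is used with [j] and
   [l] exchanged. *)
- move=> j k l n_gt0; rewrite (qmultinom_rev q j).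
  rewrite qmultinomC_rec //; last by lia.
  rewrite [LHS](ACl (3*2*1)) (addnC l k); congr (_ + _ + _).
  + case: j {n_gt0} => [|j] //. by rewrite (qmultinom_rev q l).
  + by case: k {n_gt0} => [|k] //; rewrite qmultinomC23 (qmultinomC12 q l) qmultinomC23.
  + by case: l {n_gt0} => [|l] //; rewrite (qmultinomC12 q l) qmultinomC23 (qmultinomC12 q j).
- by rewrite /= !mulr1 expr0 scale1r z_star_z.
Qed.

End SUq3Theory.

(** * Relations of U_q(su(3)), those for the F_i being adjoints of those for the E_i, and its
    counit *)

Section Uqsu3Theory.
Variables (R : realType) (q : R).
Hypotheses (q_gt0 : 0 < q) (q_lt1 : q < 1).
Local Notation U := (Uqsu3 q).
Local Notation Q := (q%:C%C : R[i]).
Local Notation K := (uK q).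
Local Notation Ki := (uKi q).
Local Notation E := (uE q).
Local Notation F := (uF q).
Local Notation Urel := (pcls_rel (P := Uqsu3_pres q)).
Local Notation Urel_star := (pcls_rel_star (P := Uqsu3_pres q)).

Lemma conj_Nqpow n : (- qpow q n)^* = - qpow q n.
Proof. by rewrite rmorphN; congr (- _); apply: conjC_real. Qed.

Lemma uclass_scal c h : uclass q (Mul (Scal c) h) = c *: uclass q h.
Proof. exact: pclsZ. Qed.

Lemma uK_uKi i : K i * Ki i = 1.
Proof. by have := Urel (U_rel_KKi q i); rewrite !pclsE scale1r. Qed.

Lemma uF_uK i : F i * K i = Q *: (K i * F i).
Proof.
have := Urel_star (U_rel_KE q i); rewrite /= !pclsE => ->.
by rewrite qpowE conjC_real.
Qed.

Lemma uF_uK_neq i j : i != j -> F j * K i = (qhalf q (-1)) *: (K i * F j).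
Proof.
move=> ij; have := Urel_star (U_rel_KE' q ij); rewrite /= !pclsE => ->.
by rewrite conjC_real.
Qed.

Lemma uF_uE i : F i * E i = E i * F i - (Q - Q^-1)^-1 *: (K i * K i - Ki i * Ki i).
Proof.
have := Urel (U_rel_EF q i); rewrite !pclsE !qpowE !scaleN1r => <-.
by rewrite opprB addrC subrK.
Qed.

Lemma uE_uF_comm i j : i != j -> E i * F j = F j * E i.
Proof.
move=> ij; have := Urel (U_rel_EF' q ij).
by rewrite !pclsE scaleN1r scale0r => /eqP; rewrite subr_eq0 => /eqP.
Qed.

Lemma uF_Serre i j : i != j ->
  F j * F i * F i + F i * F i * F j = (Q + Q^-1) *: (F i * F j * F i).
Proof.
move=> ij; have := Urel_star (U_rel_Serre q ij); rewrite /= !pclsE !mulrA => ->.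
by rewrite !qpowE rmorphD /= fmorphV /= conjC_real.
Qed.

Lemma counitD (h k : U) : counit (h + k) = counit h + counit k.
Proof. exact: palg_augD. Qed.

Lemma counitM (h k : U) : counit (h * k) = counit h * counit k.
Proof. exact: palg_augM. Qed.

Lemma counitZ c (h : U) : counit (c *: h) = c * counit h.
Proof. exact: palg_augZ. Qed.

Lemma counit1 : counit (1 : U) = 1.
Proof. exact: palg_aug1. Qed.

Lemma counit_gen x : counit (uclass q (Gen x)) = Ugen_counit R x.
Proof. exact: palg_aug_cls. Qed.

Lemma ustar_gen x : ustar (uclass q (Gen x)) = uclass q (Gen (Ugen_star x)).
Proof. exact: palg_star_cls. Qed.

Lemma ustarZ c (h : U) : ustar (c *: h) = c^* *: ustar h.
Proof. exact: palg_starZ. Qed.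

End Uqsu3Theory.

(** * Linearity of the action, twisted Leibniz rules and compatibility with adjoints *)

Section ActionTheory.
Variables (R : realType) (q : R) (act : SUq3 q -> Uqsu3 q -> SUq3 q).
Hypotheses (q_gt0 : 0 < q) (q_lt1 : q < 1) (actP : Uq_action act).
Local Notation A := (SUq3 q).
Local Notation U := (Uqsu3 q).
Local Notation Q := (q%:C%C : R[i]).
Local Notation K := (uK q).
Local Notation Ki := (uKi q).
Local Notation E := (uE q).
Local Notation F := (uF q).
Implicit Types (a b x y : A) (h : U) (i : 'I_2).
Local Notation "a <| h" := (act a h) (at level 40, left associativity).

Lemma actD a b h : (a + b) <| h = a <| h + b <| h.
Proof. by have := act_linearl actP h 1 a b; rewrite !scale1r. Qed.

Lemma act0 h : 0 <| h = 0.
Proof. by apply: (addrI (0 <| h)); rewrite -actD !addr0. Qed.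

Lemma actZ c a h : (c *: a) <| h = c *: (a <| h).
Proof. by have := act_linearl actP h c a 0; rewrite act0 !addr0. Qed.

Lemma actN a h : (- a) <| h = - (a <| h).
Proof. by rewrite -scaleN1r actZ scaleN1r. Qed.

Lemma act_sum (I : Type) (r : seq I) (P : pred I) (G : I -> A) h :
  (\sum_(i <- r | P i) G i) <| h = \sum_(i <- r | P i) (G i <| h).
Proof. by apply: (big_morph (act^~ h)) => [a b|]; rewrite ?actD ?act0. Qed.

Lemma actrD a h (k : U) : a <| (h + k) = a <| h + a <| k.
Proof. by have := act_linearr actP a 1 h k; rewrite !scale1r. Qed.

Lemma actr0 a : a <| 0 = 0.
Proof. by apply: (addrI (a <| 0)); rewrite -actrD !addr0. Qed.

Lemma actrZ c a h : a <| (c *: h) = c *: (a <| h).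
Proof. by have := act_linearr actP a c h 0; rewrite actr0 !addr0. Qed.

Lemma actrN a h : a <| (- h) = - (a <| h).
Proof. by rewrite -scaleN1r actrZ scaleN1r. Qed.

Lemma actM_K i a b : (a * b) <| K i = (a <| K i) * (b <| K i).
Proof. by rewrite (act_mull actP) /= big_seq1. Qed.

Lemma actM_E i a b : (a * b) <| E i = (a <| E i) * (b <| K i) + (a <| Ki i) * (b <| E i).
Proof. by rewrite (act_mull actP) /= big_cons big_seq1. Qed.

Lemma actM_F i a b : (a * b) <| F i = (a <| F i) * (b <| K i) + (a <| Ki i) * (b <| F i).
Proof. by rewrite (act_mull actP) /= big_cons big_seq1. Qed.

Lemma act_1K i : 1 <| K i = 1.
Proof. by rewrite (act_1l actP) counit_gen scale1r. Qed.

Lemma act_1E i : 1 <| E i = 0.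
Proof. by rewrite (act_1l actP) counit_gen scale0r. Qed.

Lemma act_1F i : 1 <| F i = 0.
Proof. by rewrite (act_1l actP) counit_gen scale0r. Qed.

Lemma act_Ki_eigen c a i : c != 0 -> a <| K i = c *: a -> a <| Ki i = c^-1 *: a.
Proof.
move=> c0 aK; apply: (scalerI c0); rewrite -actZ -aK -(act_mulr actP) uK_uKi.
by rewrite (act_1r actP) scalerA divff ?scale1r.
Qed.

Lemma star_act_Ki i a : star (a <| Ki i) = star a <| K i.
Proof. by rewrite (act_star actP) /= ustar_gen. Qed.

Lemma star_act_E i a : star (a <| E i) = - Q *: (star a <| F i).
Proof.
by rewrite (act_star actP) /= uclass_scal ustarZ ustar_gen actrZ conj_Nqpow qpowE.
Qed.

Lemma star_act_F i a : star (a <| F i) = - Q^-1 *: (star a <| E i).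
Proof.
rewrite (act_star actP) /= uclass_scal ustarZ ustar_gen actrZ.
by rewrite conj_Nqpow qpowE.
Qed.

Local Notation i1 := (ord0 : 'I_2).
Local Notation i2 := (ord_max : 'I_2).

(** * Invariants of U_q(su(2)), tested on generators *)

Definition su2_invariant a := [/\ a <| K i1 = a, a <| E i1 = 0 & a <| F i1 = 0].

Lemma su2_invariant_Ki a : su2_invariant a -> a <| Ki i1 = a.
Proof.
case=> aK _ _; have := @act_Ki_eigen 1 a i1 (oner_neq0 _).
by rewrite invr1 !scale1r; apply.
Qed.

Lemma S5qP a : S5q act a <-> su2_invariant a.
Proof.
split=> [inv|inv].
  split; rewrite inv; try constructor; rewrite counit_gen /=;
  by rewrite ?scale1r ?scale0r.
have aKi := su2_invariant_Ki inv; case: inv => aK aE aF.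
move=> h; elim=> {h}; rewrite ?counit_gen ?scale1r ?scale0r //.
- by rewrite (act_1r actP) counit1 scale1r.
- by move=> c h _ ah; rewrite actrZ ah counitZ scalerA.
- by move=> h k _ ah _ ak; rewrite actrD ah ak counitD scalerDl.
- by move=> h k _ ah _ ak; rewrite (act_mulr actP) ah actZ ak scalerA counitM.
Qed.

Lemma su2_invariantM a b : su2_invariant a -> su2_invariant b -> su2_invariant (a * b).
Proof.
move=> ia ib; have aKi := su2_invariant_Ki ia; case: ia ib => aK aE aF [bK bE bF].
split; first by rewrite actM_K aK bK.
  by rewrite actM_E aE bE mul0r mulr0 addr0.
by rewrite actM_F aF bF mul0r mulr0 addr0.
Qed.

Lemma su2_invariant1 : su2_invariant 1.
Proof. by split; rewrite ?act_1K ?act_1E ?act_1F. Qed.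

Lemma su2_invariantZ c a : su2_invariant a -> su2_invariant (c *: a).
Proof. by case=> aK aE aF; split; rewrite actZ ?aK ?aE ?aF ?scaler0. Qed.

(** Adjunction exchanges the actions of E_1 and F_1 up to nonzero scalars, and those of K_1 and its
    inverse. *)
Lemma su2_invariant_star a : su2_invariant a -> su2_invariant (star a).
Proof.
move=> ia; have aKi := su2_invariant_Ki ia; case: (ia) => aK aE aF.
have Q0 := Q_neq0 q_gt0.
split.
- by rewrite -[in RHS]aKi star_act_Ki.
- have := star_act_F i1 a; rewrite aF star0 => /esym/eqP.
  by rewrite scaler_eq0 oppr_eq0 invr_eq0 (negPf Q0) => /eqP.
- have := star_act_E i1 a; rewrite aE star0 => /esym/eqP.
  by rewrite scaler_eq0 oppr_eq0 (negPf Q0) => /eqP.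
Qed.

(** * Powers of the square root of q, and positivity of the spectrum of K_2 *)

Lemma qhalf_gt0 n : 0 < qhalf q n.
Proof. by rewrite ltcR exprz_gt0 ?sqrtr_gt0. Qed.

Lemma qhalf_neq0 n : qhalf q n != 0.
Proof. by rewrite gt_eqF ?qhalf_gt0. Qed.

Lemma qhalfD m n : qhalf q (m + n) = qhalf q m * qhalf q n.
Proof. by rewrite /qhalf expfzDr ?rmorphM // gt_eqF ?sqrtr_gt0. Qed.

Lemma qhalf0 : qhalf q 0 = 1.
Proof. by rewrite /qhalf expr0z. Qed.

Lemma qhalfN n : qhalf q (- n) = (qhalf q n)^-1.
Proof.
apply: (mulIf (qhalf_neq0 n)).
by rewrite mulVf ?qhalf_neq0 // -qhalfD addNr qhalf0.
Qed.

Lemma qpow_qhalf n : qpow q n = qhalf q n * qhalf q n.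
Proof.
by rewrite /qpow /qhalf -rmorphM -expfzMl -expr2 sqr_sqrtr ?ltW.
Qed.

Lemma Q_qhalf : Q = qhalf q 2.
Proof. by rewrite -[Q]expr1z -qpowE qpow_qhalf -qhalfD. Qed.

Lemma conj_qhalf n : (qhalf q n)^* = qhalf q n.
Proof. exact: conjC_real. Qed.

Lemma star_K_eigen c a i : c != 0 ->
  a <| K i = c *: a -> star a <| K i = (c^-1)^* *: star a.
Proof. by move=> c0 aK; rewrite -star_act_Ki (act_Ki_eigen c0 aK) starZ. Qed.

Lemma actM_K_eigen c d a b i :
  a <| K i = c *: a -> b <| K i = d *: b -> (a * b) <| K i = (c * d) *: (a * b).
Proof. by move=> aK bK; rewrite actM_K aK bK -scalerAl -scalerAr scalerA. Qed.

Inductive K2_diag : A -> Prop :=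
| K2_diag_eigen c a : 0 < c -> a <| K i2 = c *: a -> K2_diag a
| K2_diagD a b : K2_diag a -> K2_diag b -> K2_diag (a + b).

Lemma K2_diagM a b : K2_diag a -> K2_diag b -> K2_diag (a * b).
Proof.
elim=> {a} [c a c_gt0 aK|a1 a2 _ IH1 _ IH2] db; last by rewrite mulrDl; apply: K2_diagD; auto.
elim: db => {b} [d b d_gt0 bK|b1 b2 _ IH1 _ IH2]; last by rewrite mulrDr; apply: K2_diagD.
by apply: (K2_diag_eigen (mulr_gt0 c_gt0 d_gt0)); apply: actM_K_eigen.
Qed.

(** As K_2 is group-like, eigenvalues multiply under products, so only generators matter. Passing to
    the adjoint inverts a real eigenvalue, which stays positive. *)
Lemma K2_diag_all a : K2_diag a.
Proof.
have umatK (k l : 'I_3) : umat q k l <| K i2 = qhalf q _ *: umat q k l := act_K actP i2 k l.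
elim/pcls_ind: a; elim=> [[k l|k l]|c|s IHs t IHt|s IHs t IHt].
- by apply: K2_diag_eigen (umatK k l); apply: qhalf_gt0.
- have -> : pcls (P := SUq3_pres q) (Gen (Gus k l)) = star (umat q k l) by rewrite /star palg_star_cls.
  apply: K2_diag_eigen (star_K_eigen _ (umatK k l)); last exact: qhalf_neq0.
  by rewrite -qhalfN conj_qhalf qhalf_gt0.
- by rewrite pcls_scal; apply: (@K2_diag_eigen 1); rewrite ?ltr01 // actZ act_1K scale1r.
- by rewrite pcls_add; apply: K2_diagD.
- by rewrite pcls_mul; apply: K2_diagM.
Qed.

Lemma act_horner_eigen c a h (p : {poly R[i]}) :
  a <| h = c *: a -> a <| horner_alg h p = p.[c] *: a.
Proof.
move=> ah; elim/poly_ind: p => [|p d IHp]; first by rewrite rmorph0 actr0 horner0 scale0r.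
rewrite rmorphD rmorphM /= horner_algX horner_algC actrD (act_mulr actP) IHp actZ ah.
by rewrite actrZ (act_1r actP) scalerA -scalerDl !hornerE.
Qed.

(* Indeed [a] is annihilated by a polynomial in [K_2] without negative roots. *)
Lemma K2_eigen_neg_eq0 c a : 0 < c -> a <| K i2 = - c *: a -> a = 0.
Proof.
move=> c_gt0 aK.
have [p p_c ap] : exists2 p : {poly R[i]}, p.[- c] != 0 & a <| horner_alg (K i2) p = 0.
  elim: (K2_diag_all a) => {a aK} [d a d_gt0 aK|a b _ [p p_c ap] _ [r r_c br]].
    exists ('X - d%:P); last by rewrite (act_horner_eigen _ aK) !hornerE subrr scale0r.
    by rewrite !hornerE -opprD oppr_eq0 gt_eqF ?addr_gt0.
  exists (p * r); first by rewrite hornerM mulf_neq0.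
  rewrite actD {1}rmorphM (mulrC p) rmorphM /= !(act_mulr actP) ap br.
  by rewrite !act0 addr0.
move: ap; rewrite (act_horner_eigen _ aK) => /eqP.
by rewrite scaler_eq0 (negPf p_c) => /eqP.
Qed.

(** The difference of the two sides is an eigenvector of K_2 for -c, hence zero. *)
Lemma K2_sqrt_eigen c a : 0 < c -> a <| K i2 <| K i2 = (c * c) *: a -> a <| K i2 = c *: a.
Proof.
move=> c_gt0 aKK; apply/eqP; rewrite -subr_eq0; apply/eqP/(K2_eigen_neg_eq0 c_gt0).
by rewrite actD actN aKK actZ scaleNr scalerBr scalerA opprB.
Qed.

(** * The line bundles as weight spaces of K_2 among the invariants *)

Lemma act_K1K2K2 a : a <| (K i1 * K i2 ^+ 2) = a <| K i1 <| K i2 <| K i2.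
Proof. by rewrite !(act_mulr actP). Qed.

Lemma line_bundleP N a :
  line_bundle act N a <-> su2_invariant a /\ a <| K i2 = qhalf q N *: a.
Proof.
split=> [[/S5qP ia]|[ia aK]].
  rewrite act_K1K2K2 qpow_qhalf; case: (ia) => -> _ _ aKK; split=> //.
  exact: (K2_sqrt_eigen (qhalf_gt0 N)).
split; first exact/S5qP.
by rewrite act_K1K2K2; case: ia => -> _ _; rewrite aK actZ aK scalerA qpow_qhalf.
Qed.

Lemma line_bundleM M N a b :
  line_bundle act M a -> line_bundle act N b -> line_bundle act (M + N) (a * b).
Proof.
move=> /line_bundleP[ia aK] /line_bundleP[ib bK]; apply/line_bundleP.
by split; [apply: su2_invariantM | rewrite qhalfD; apply: actM_K_eigen].
Qed.

Lemma line_bundle1 : line_bundle act 0 1.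
Proof.
by apply/line_bundleP; rewrite qhalf0 scale1r act_1K; split=> //; apply: su2_invariant1.
Qed.

Lemma line_bundleX N a n : line_bundle act N a -> line_bundle act (N *+ n) (a ^+ n).
Proof.
move=> La; elim: n => [|n IHn]; first exact: line_bundle1.
by rewrite mulrS exprS; apply: line_bundleM.
Qed.

Lemma line_bundleZ N c a : line_bundle act N a -> line_bundle act N (c *: a).
Proof.
move=> /line_bundleP[ia aK]; apply/line_bundleP; split; first exact: su2_invariantZ.
by rewrite actZ aK !scalerA mulrC.
Qed.

Lemma line_bundle_star N a : line_bundle act N a -> line_bundle act (- N) (star a).
Proof.
move=> /line_bundleP[ia aK]; apply/line_bundleP; split; first exact: su2_invariant_star.
by rewrite (star_K_eigen (qhalf_neq0 N) aK) -qhalfN conj_qhalf.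
Qed.

Lemma line_bundle_z j : line_bundle act 1 (z q j).
Proof.
apply/line_bundleP; rewrite /su2_invariant /z !(act_K actP) (act_E actP) (act_F actP) /=.
by rewrite qhalf0 scale1r.
Qed.

Lemma line_bundle_zmono j k l : line_bundle act (j + k + l)%N (zmono q j k l).
Proof.
by rewrite !PoszD; do 2?apply: line_bundleM; rewrite -natz; apply/line_bundleX/line_bundle_z.
Qed.

(** F_2 takes the second row of u to the third and kills the third, where the z_i lie; its Leibniz
    rule does the rest. *)
Lemma zmono_F2 j k l : zmono q j k l <| F i2 = 0.
Proof.
have M0 a b : a <| F i2 = 0 -> b <| F i2 = 0 -> (a * b) <| F i2 = 0.
  by move=> aF bF; rewrite actM_F aF bF mul0r mulr0 addr0.
have X0 a n : a <| F i2 = 0 -> a ^+ n <| F i2 = 0.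
  by move=> aF; elim: n => [|n IHn]; [apply: act_1F | rewrite exprS M0].
have z0 (m : 'I_3) : z q m <| F i2 = 0 by rewrite /z (act_F actP).
by rewrite /zmono !M0 ?X0.
Qed.

(** * The components of Psi_N and its normalization *)

Local Notation triple N := ('I_`|N|.+1 * 'I_`|N|.+1 * 'I_`|N|.+1)%type.

Definition triples N : pred (triple N) :=
  fun t => (t.1.1 + t.1.2 + t.2 == `|N|)%N.

Arguments triples N t : clear implicits.

Lemma psi_star_zmono N j k l : exists c : R[i],
  psi_star q N j k l = c *: (if 0 <= N then zmono q j k l else star (zmono q j k l)).
Proof. by rewrite /psi_star; case: ifP => _; eexists. Qed.

Lemma line_bundle_psi_star N j k l : (j + k + l)%N = `|N|%N ->
  line_bundle act N (psi_star q N j k l).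
Proof.
move=> jkl; have [c ->] := psi_star_zmono N j k l; apply: line_bundleZ.
have := line_bundle_zmono j k l; rewrite jkl.
case: ifP => N0; first by rewrite gez0_abs.
by move=> /line_bundle_star; rewrite ltz0_abs ?opprK // ltNge N0.
Qed.

Lemma line_bundle_psi N j k l : (j + k + l)%N = `|N|%N ->
  line_bundle act (- N) (psi q N j k l).
Proof. by move=> jkl; apply/line_bundle_star/line_bundle_psi_star. Qed.

Lemma psi_partition N :
  \sum_(t | triples N t) psi_star q N t.1.1 t.1.2 t.2 * psi q N t.1.1 t.1.2 t.2 = 1.
Proof.
rewrite -(boxsumE _ _ (fun j k l => psi_star q N j k l * psi q N j k l)).
have sqrt2 j k l : Num.sqrt (qmultinom q j k l) * Num.sqrt (qmultinom q j k l) = qmultinom q j k l.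
  by rewrite -expr2 sqr_sqrtr // ltW ?qmultinom_gt0.
rewrite /psi /psi_star; have [N0|N0] := boolP (0 <= N).
  rewrite -[RHS](zmono_partition q_gt0 (n := `|N|) q_lt1 (leqnn _)).
  apply: eq_boxsum => j k l _; rewrite starZ conjC_real -scalerAl -scalerAr scalerA.
  by rewrite -rmorphM sqrt2.
rewrite -[RHS](star_zmono_partition q_gt0 (n := `|N|) q_lt1 (leqnn _)).
apply: eq_boxsum => j k l jkl; rewrite starZ conjC_real starK -scalerAl -scalerAr !scalerA.
(* Here -N = j + k + l, so the exponent -N + j - l of the component is 2j + k; its square is the
   weight in [star_zmono_partition]. *)
congr (_ *: _); have -> : - N + j%:Z - l%:Z = (j.*2 + k)%N.
  by rewrite -[- N]ltz0_abs ?ltNge // -jkl !PoszD -addnn PoszD; ring.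
rewrite -!rmorphXn -!rmorphM -exprnP -[RHS]/(_%:C%C); congr (_%:C%C).
by rewrite -(addnn (_ + _)) [in RHS]exprD mulrACA sqrt2 mulrC.
Qed.

(* For N >= 0, [F_2] kills Psi_N^dagger, so it suffices to let it act on both
   sides of Psi_N^dagger Psi_N = 1; for N < 0 it kills Psi_N. *)
Lemma psi_star_psi_F2 N :
  \sum_(t | triples N t) psi_star q N t.1.1 t.1.2 t.2 * (psi q N t.1.1 t.1.2 t.2 <| F i2) = 0.
Proof.
have [N0|N0] := boolP (0 <= N); last first.
  rewrite big1 // => t _; rewrite /psi; have [c ->] := psi_star_zmono N t.1.1 t.1.2 t.2.
  by rewrite (negPf N0) starZ starK actZ zmono_F2 scaler0 mulr0.
have := act_1F i2; rewrite -(psi_partition N) act_sum.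
rewrite (eq_bigr (fun t : triple N => (qhalf q N)^-1 *: (psi_star q N t.1.1 t.1.2 t.2 *
    (psi q N t.1.1 t.1.2 t.2 <| F i2)))) => [|t /eqP/line_bundle_psi_star/line_bundleP[_ tK]].
  by rewrite -scaler_sumr => /eqP; rewrite scaler_eq0 invr_eq0 (negPf (qhalf_neq0 _)) => /eqP.
rewrite actM_F (act_Ki_eigen (qhalf_neq0 _) tK) -scalerAl.
have [c ->] := psi_star_zmono N t.1.1 t.1.2 t.2.
by rewrite N0 actZ zmono_F2 scaler0 mul0r add0r.
Qed.

(** * Reduction of the connection on the line bundle to a multiple of dbar *)

Lemma actM_F1_invariant a b : su2_invariant a -> (a * b) <| F i1 = a * (b <| F i1).
Proof.
by move=> ia; rewrite actM_F (su2_invariant_Ki ia); case: ia => _ _ ->; rewrite mul0r add0r.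
Qed.

Lemma actM_invariant_F1 a b : su2_invariant b -> (a * b) <| F i1 = (a <| F i1) * b.
Proof. by case=> bK _ bF; rewrite actM_F bK bF mulr0 addr0. Qed.

Lemma actM_invariant_E1 a b : su2_invariant b -> (a * b) <| E i1 = (a <| E i1) * b.
Proof. by case=> bK bE _; rewrite actM_E bK bE mulr0 addr0. Qed.

Lemma dbar0E a : dbar0 act a = (a <| F i2 <| F i1, a <| F i2).
Proof. by rewrite /dbar0 (act_mulr actP). Qed.

Lemma sum_pair (I : Type) (r : seq I) (P : pred I) (G H : I -> A) :
  \sum_(i <- r | P i) (G i, H i) = (\sum_(i <- r | P i) G i, \sum_(i <- r | P i) H i).
Proof.
by apply: injective_projections; [apply: (big_morph fst)|apply: (big_morph snd)].
Qed.

Lemma nabla0E N xi : line_bundle act N xi ->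
  nabla0 act N xi = qhalf q (- N) *: dbar0 act xi.
Proof.
move=> Lxi; rewrite /nabla0.
pose s (t : triple N) := psi_star q N t.1.1 t.1.2 t.2.
pose p (t : triple N) := psi q N t.1.1 t.1.2 t.2.
(* The terms in which F_2 hits [psi] add up to 0 by [psi_star_psi_F2]; in the others the inverse of
   K_2 acts on [psi], of degree -N, by q^(N/2). *)
have sumF2 : \sum_(t | triples N t) s t * ((p t * xi) <| F i2) = qhalf q N *: (xi <| F i2).
  rewrite (eq_bigr (fun t : triple N => s t * (p t <| F i2) * (xi <| K i2) +
      qhalf q N *: (s t * p t * (xi <| F i2)))) => [|t /eqP/line_bundle_psi/line_bundleP[_ tK]].
    by rewrite big_split /= -scaler_sumr -!mulr_suml psi_star_psi_F2 psi_partition mul0r mul1r add0r.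
  rewrite actM_F (act_Ki_eigen (qhalf_neq0 _) tK) mulrDr -scalerAl -scalerAr !mulrA.
  by rewrite -qhalfN opprK.
(* The components of the adjoint of Psi_N are invariant under U_q(su(2)), so F_1 can be applied
   after the sum, to [sumF2]. *)
have sumF1 : \sum_(t | triples N t) s t * ((p t * xi) <| F i2 <| F i1) =
    qhalf q N *: (xi <| F i2 <| F i1).
  rewrite -actZ -sumF2 act_sum; apply: eq_bigr => t /eqP/line_bundle_psi_star/line_bundleP[invs _].
  by rewrite actM_F1_invariant //.
have c0 : qpow q (- N) * qhalf q N = qhalf q (- N).
  by rewrite qpow_qhalf -mulrA -qhalfD addNr qhalf0 mulr1.
rewrite -c0 -scalerA; congr (_ *: _); rewrite dbar0E -[RHS]/(_ *: _, _ *: _) -sumF1 -sumF2.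
rewrite -sum_pair; apply: eq_bigr => t _.
by rewrite /pair_lmul dbar0E.
Qed.

(** * The operator dbar on pairs: its square and its Leibniz rule *)

Lemma Serre_act xi : xi <| F i1 = 0 ->
  xi <| F i2 <| F i2 <| F i1 = (qnum q 2)%:C%C *: (xi <| F i2 <| F i1 <| F i2).
Proof.
move=> xF; have i21 : i2 != i1 by [].
have := congr1 (act xi) (uF_Serre q i21).
rewrite actrD actrZ !(act_mulr actP) xF !act0 add0r => ->.
by rewrite qnum2 // rmorphD /= fmorphV.
Qed.

Lemma dbar1_dbar0 xi : xi <| F i1 = 0 -> dbar1 act (dbar0 act xi) = 0.
Proof.
by move=> xF; rewrite dbar0E /dbar1 /= (act_mulr actP) Serre_act // subrr.
Qed.

Lemma dbar1Z c v : dbar1 act (c *: v) = c *: dbar1 act v.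
Proof. by rewrite /dbar1 /= !actZ scalerBr !scalerA mulrC. Qed.

Lemma dbar1_sum (I : Type) (r : seq I) (G : I -> A * A) :
  dbar1 act (\sum_(i <- r) G i) = \sum_(i <- r) dbar1 act (G i).
Proof.
apply: (big_morph (dbar1 act)) => [v w|]; last by rewrite /dbar1 /= !act0 scaler0 subrr.
by rewrite /dbar1 /= !actD scalerDr opprD addrACA.
Qed.

(** Dividing the eigenvalue q^(3/2) of K_1 K_2^2 by that of K_1 gives q and q^2 for the square of
    K_2; positivity selects the roots. *)
Lemma Omega01_eigen v : Omega01 act v ->
  [/\ v.1 <| K i1 = qhalf q 1 *: v.1, v.1 <| K i2 = qhalf q 1 *: v.1,
      v.2 <| K i1 = qhalf q (-1) *: v.2 & v.2 <| K i2 = qhalf q 2 *: v.2].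
Proof.
case: v => v1 v2 [[+ +] [v1K v2K] _ _] /=; rewrite !act_K1K2K2 v1K v2K !actZ => v1KK v2KK.
split=> //; apply: (K2_sqrt_eigen (qhalf_gt0 _)).
  by apply: (scalerI (qhalf_neq0 1)); rewrite v1KK scalerA -!qhalfD.
by apply: (scalerI (qhalf_neq0 (-1))); rewrite v2KK scalerA -!qhalfD.
Qed.

(** When F_1 hits v_- it produces v_+, giving an extra term q^(-3/2) v_+ (xi <| F_2). It cancels
    against one half of [2] q^(-1/2) = q^(1/2) + q^(-3/2), and the remaining mixed terms form the
    wedge product. *)
Lemma dbar1_Leibniz N v xi : Omega01 act v -> line_bundle act N xi ->
  dbar1 act (pair_rmul v xi) =
  qhalf q N *: (dbar1 act v * xi) - wedge v (dbar0 act xi).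
Proof.
move=> Ov /line_bundleP[ixi xiK]; have [v1K1 v1K2 v2K1 v2K2] := Omega01_eigen Ov.
case: v Ov v1K1 v1K2 v2K1 v2K2 => v1 v2 [_ _ [v1F v2F] _] /= v1K1 v1K2 v2K1 v2K2.
have mulF2 c a : c != 0 -> a <| K i2 = c *: a ->
    (a * xi) <| F i2 = qhalf q N *: ((a <| F i2) * xi) + c^-1 *: (a * (xi <| F i2)).
  by move=> c0 aK; rewrite actM_F xiK (act_Ki_eigen c0 aK) -scalerAr -scalerAl.
rewrite /dbar1 /pair_rmul /wedge dbar0E /= !(act_mulr actP).
rewrite (mulF2 _ _ (qhalf_neq0 _) v1K2) (mulF2 _ _ (qhalf_neq0 _) v2K2).
rewrite actD !actZ (actM_invariant_F1 _ ixi) actM_F v2F (act_Ki_eigen (qhalf_neq0 _) v2K1).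
have xiF2K : xi <| F i2 <| K i1 = qhalf q (-1) *: (xi <| F i2).
  rewrite -(act_mulr actP) uF_uK_neq // actrZ (act_mulr actP).
  by case: (ixi) => ->.
rewrite xiF2K qnum2 // rmorphD /= fmorphV /= Q_qhalf -!qhalfN.
rewrite -!scalerAl -!scalerAr !mulrBl !scalerDr !scalerA.
rewrite -!scalerAl !scalerA mulrN1 mulNr scaleNr [qhalf q N * (_ + _)]mulrC.
rewrite [(_ + _) * qhalf q (-1)]mulrDl -!qhalfD scalerDl !opprD !opprK !addrA.
by rewrite [LHS](ACl (1*4*5*3*2*6)) /= [LHS]addrK.
Qed.

(** * The connection takes values in the tensor product of the antiholomorphic forms with the line
    bundle *)

Lemma Omega01Z c v : Omega01 act v -> Omega01 act (c *: v).
Proof.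
case: v => v1 v2 [[v1K v2K] [v1K1 v2K1] [v1F v2F] [v1E v2E]].
split; rewrite /pair_act /= !actZ; congr (_, _);
  by rewrite ?v1K ?v2K ?v1K1 ?v2K1 ?v1F ?v2F ?v1E ?v2E ?scaler0 // !scalerA mulrC.
Qed.

(** The factor [a] brings the degree back to 0, so the K-weights are those of forms; being
    invariant, it does not interfere with E_1 and F_1. *)
Lemma Omega01_dbar0_mul N xi a : line_bundle act N xi -> line_bundle act (- N) a ->
  Omega01 act (pair_rmul (dbar0 act xi) a).
Proof.
move=> /line_bundleP[ixi xiK2] /line_bundleP[ia aK2].
have [xiK1 xiE1 xiF1] := ixi; have [aK1 _ _] := ia.
have i12 : i1 != i2 by []. have i21 : i2 != i1 by [].
have wtF i b c : b <| K i = c *: b -> b <| F i <| K i = (qhalf q 2 * c) *: (b <| F i).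
  by move=> bK; rewrite -(act_mulr actP) uF_uK actrZ (act_mulr actP) bK actZ scalerA Q_qhalf.
have wtF' i j b c : i != j -> b <| K i = c *: b ->
    b <| F j <| K i = (qhalf q (-1) * c) *: (b <| F j).
  by move=> ij bK; rewrite -(act_mulr actP) uF_uK_neq // actrZ (act_mulr actP) bK actZ scalerA.
have v2K1 : xi <| F i2 <| K i1 = qhalf q (-1) *: (xi <| F i2).
  by rewrite (wtF' _ _ _ 1) ?scale1r ?mulr1.
have v2K2 := wtF _ _ _ xiK2.
have v1K1 := wtF _ _ _ v2K1.
have v1K2 := wtF' _ _ _ _ i21 v2K2.
have aK1' : a <| K i1 = 1 *: a by rewrite scale1r.
rewrite dbar0E /pair_rmul; split; rewrite /pair_act /= ?act_K1K2K2.
- rewrite !(actM_K_eigen v1K1 aK1', actM_K_eigen v2K1 aK1', actZ, actM_K_eigen v1K2 aK2, actM_K_eigen v2K2 aK2).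
  rewrite !scalerA; congr (_ *: _, _ *: _); rewrite mulr1 -!qhalfD; congr qhalf; ring.
- rewrite (actM_K_eigen v1K1 aK1') (actM_K_eigen v2K1 aK1') !mulr1 -qhalfD //.
- rewrite !actM_invariant_F1 //; congr (_, _).
  (* The Serre relation quadratic in F_1: as F_1 kills [xi], only F_2 F_1^2 survives, so it kills
     [xi] too. *)
  have := congr1 (act xi) (uF_Serre q i12).
  rewrite actrD actrZ !(act_mulr actP) xiF1 !act0 scaler0 addr0 => ->.
  by rewrite mul0r.
- rewrite !actM_invariant_E1 //.
  have v2E : xi <| F i2 <| E i1 = 0.
    by rewrite -(act_mulr actP) -uE_uF_comm // (act_mulr actP) xiE1 act0.
  (* E_1 kills xi <| F_2, a K_1-eigenvector for q^(-1/2). The commutator of E_1 and F_1 therefore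
     brings v_+ back to v_- with the scalar (q - q^-1) / (q - q^-1) = 1. *)
  rewrite v2E mul0r -(act_mulr actP) uF_uE actrD actrN actrZ actrD actrN !(act_mulr actP).
  rewrite v2E act0 v2K1 actZ v2K1 (act_Ki_eigen (qhalf_neq0 _) v2K1) actZ.
  rewrite (act_Ki_eigen (qhalf_neq0 _) v2K1) -qhalfN add0r !scalerA -!qhalfD -scalerBl scalerA.
  congr (_ * _, _); rewrite -scaleNr -[RHS]scale1r; congr (_ *: _).
  rewrite Q_qhalf -qhalfN (_ : - 1 - 1 = - 2 :> int) // (_ : - - 1 - - 1 = 2 :> int) //.
  rewrite -mulrN opprB mulVf // subr_eq0 qhalfN -Q_qhalf -fmorphV /= (inj_eq (@complexI _)).
  by rewrite lt_eqF // (lt_trans q_lt1) // invf_gt1.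
Qed.

(** The partition of unity for -N is inserted on the right: the adjoint components have degree -N
    and turn nabla xi into forms, while the components of Psi_(-N) lie in L_N. *)
Lemma Omega01_line_nabla0 N xi : line_bundle act N xi -> Omega01_line act N (nabla0 act N xi).
Proof.
move=> Lxi; pose P := triples (- N).
pose s (t : triple (- N)) := psi_star q (- N) t.1.1 t.1.2 t.2.
pose p (t : triple (- N)) := psi q (- N) t.1.1 t.1.2 t.2.
exists #|P|, (fun m => pair_rmul (nabla0 act N xi) (s (enum_val m))), (fun m => p (enum_val m)).
have tP (m : 'I_#|P|) : ((enum_val m).1.1 + (enum_val m).1.2 + (enum_val m).2)%N = `|- N|%N.
  exact: eqP (enum_valP m).
split=> [m|m|].
- have -> : pair_rmul (nabla0 act N xi) (s (enum_val m)) =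
      qhalf q (- N) *: pair_rmul (dbar0 act xi) (s (enum_val m)).
    by rewrite nabla0E // /pair_rmul /= -!scalerAl.
  exact/Omega01Z/(Omega01_dbar0_mul Lxi)/line_bundle_psi_star.
- by have := line_bundle_psi (tP m); rewrite opprK.
have <- := big_enum_val (fun t => pair_rmul (pair_rmul (nabla0 act N xi) (s t)) (p t)).
case: (nabla0 act N xi) => v1 v2; rewrite sum_pair /=.
under eq_bigr do rewrite -mulrA.
under [X in _ = (_, X)]eq_bigr do rewrite -mulrA.
by rewrite -!mulr_sumr psi_partition !mulr1.
Qed.

End ActionTheory.

Theorem proposition4p2 (R : realType) (q : R) (N : int)
    (act : SUq3 q -> Uqsu3 q -> SUq3 q) :
  0 < q -> q < 1 -> Uq_action act ->
  exists D : SUq3 q * SUq3 q -> SUq3 q,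
    is_nabla1 act N D /\
    forall xi : SUq3 q, line_bundle act N xi ->
      Omega01_line act N (nabla0 act N xi) /\ D (nabla0 act N xi) = 0.
Proof.
(* The witness is defined on all pairs, so independence of the chosen representation as a sum of
   products is automatic. *)
move=> q_gt0 q_lt1 actP; exists (fun v => qhalf q (- N) *: dbar1 act v).
split=> [n w xi Ow Lxi|xi Lxi].
  rewrite (dbar1_sum actP) scaler_sumr; apply: eq_bigr => i _.
  (* The prefactor q^(-N/2) cancels the q^(N/2) of the Leibniz rule and, in the wedge term, turns
     dbar xi into nabla xi. *)
  rewrite (dbar1_Leibniz q_gt0 q_lt1 actP (Ow i) (Lxi i)) (nabla0E q_gt0 q_lt1 actP (Lxi i)).
  rewrite scalerBr scalerA qhalfN // mulVf ?qhalf_neq0 // scale1r; congr (_ - _).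
  by rewrite /wedge /= -!scalerAr scalerBr !scalerA ![(qhalf q N)^-1 * _]mulrC.
split; first exact: Omega01_line_nabla0.
have [[_ _ xiF] _] := (line_bundleP q_gt0 actP N xi).1 Lxi.
by rewrite (nabla0E q_gt0 q_lt1 actP Lxi) (dbar1Z actP) (dbar1_dbar0 q_gt0 q_lt1 actP xiF) !scaler0.
Qed.
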